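(* Assume A1, A2 and A3 of the context, and let $\{\tau_j\}_{j\ge1}$, $\{g_j\}_{j\ge1}$, $\{\phi_j\}_{j\ge1}$ be the sequences described in the context, with $\phi_0=\phi_*$, $\tau_0=\beta_*$, $g_0=k_*^2$. Then there exists a $\delta_*>0$ such that all the power series $$\sum_{j=0}^\infty\phi_j\delta^j,\qquad \sum_{j=0}^\infty\tau_j\delta^j,\qquad \sum_{j=0}^\infty g_j\delta^j$$ converge for $|\delta|\le\delta_*$ (the first one in $H^1(\Omega)$).
   Context: Notation: ${\bf r}=(y,z)\in\mathbb{R}^2$, $\Delta=\partial_y^2+\partial_z^2$, $L>0$, $d>0$, $\Omega=\{(y,z): |y|<L/2,\ |z|<\infty\}$, and $(f,g)_{L^2(\Omega)}=\int_\Omega f\overline{g}\,d{\bf r}$. Equations are understood in the weak sense. BIC: for a real dielectric function $\epsilon$ that is $L$-periodic in $y$ and equal to $1$ for $|z|>d$, a bound state in the continuum (BIC) is a triple $\{u,\beta,k\}$ with $\beta\in(-\pi/L,\pi/L]$, $k>|\beta|$ real and $u\neq 0$ such that $\Delta u+k^2\epsilon u=0$ in $\Omega$, $u(L/2,z)=e^{\mathsf{i}\beta L}u(-L/2,z)$, $\partial_y u(L/2,z)=e^{\mathsf{i}\beta L}\partial_y u(-L/2,z)$ for $z\in\mathbb{R}$, and $u\to0$ as $z\to\pm\infty$ for $|y|<L/2$. Then $u=\phi e^{\mathsf{i}\beta y}$ with $\phi$ $L$-periodic in $y$. The BIC is nondegenerate if, for the given $(\beta,k)$, the space of such $u$ is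 one-dimensional. A1: $\epsilon_*\in L^\infty(\Omega)$ is real and positive, $L$-periodic in $y$, $\epsilon_*(-y,z)=\epsilon_*(y,z)=\epsilon_*(y,-z)$, and $\epsilon_*=1$ for $|z|>d$. A2: the structure with dielectric function $\epsilon_*$ has a nondegenerate BIC $\{u_*=\phi_*e^{\mathsf{i}\beta_*y},\beta_*,k_*\}$ with $|\beta_*|<k_*<2\pi/L-|\beta_*|$, scaled so that $u_*(y,z)=\overline{u_*}(-y,z)$ and $\|u_*\|_{L^2(\Omega)}=1$, and such that $(\partial_y u_*,v_* )_{L^2(\Omega)}\neq0$, where $v_*$ is the corresponding diffraction solution defined next. By nondegeneracy $u_*$ is either even ($\sigma=1$) or odd ($\sigma=-1$) in $z$. Put $\beta_m=\beta_*+2\pi m/L$, $\alpha_0=\sqrt{k_*^2-\beta_*^2}>0$, $\gamma_m=\sqrt{\beta_m^2-k_*^2}>0$ for $m\ne0$. The diffraction solution $v_*$ is a solution of $\Delta v_*+k_*^2\epsilon_*v_*=0$ in $\Omega$ with the same quasi-periodic conditions as $u_*$, with $v_*(y,-z)=\sigma v_*(y,z)$, of the form $$v_*(y,z)=e^{-\mathsf{i}\theta}e^{\mathsf{i}(\beta_*y-\alpha_0z)}+e^{\mathsf{i}\theta}e^{\mathsf{i}(\beta_*y+\alpha_0z)}+\sum_{m\neq0}b_m e^{\mathsf{i}\beta_my-\gamma_mz},\quad z>d,$$ for some real $\theta$ and constants $b_m$, with $v_*(y,z)=\overline{v_*}(-y,z)$ and $\int_\Omega\overline{v_*}\,\epsilon_*u_*\,d{\bf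 r}=0$. A3: the perturbed structure has dielectric function $\epsilon=\epsilon_*+\delta F$, where $\delta$ is a real number and $F\in L^\infty(\Omega)$ is real, $L$-periodic in $y$, satisfies $F(-y,z)=F(y,z)=F(y,-z)$, and $F=0$ for $|z|>d$. Sequences: put $\phi_0=\phi_*$, $\tau_0=\beta_*$, $g_0=k_*^2$, $\mathcal{L}_*=\Delta+2\mathsf{i}\beta_*\partial_y+k_*^2\epsilon_*-\beta_*^2$, $B_1=2(\beta_*\phi_*-\mathsf{i}\partial_y\phi_* )$, $B_2=-\epsilon_*\phi_*$, and for $j\ge1$ $$D_j=\sum_{n=1}^{j}g_{n-1}F\phi_{j-n}-\sum_{n=2}^{j}\sum_{m=1}^{n-1}\tau_m\tau_{n-m}\phi_{j-n}+\sum_{n=1}^{j-1}\left(g_n\epsilon_*-2\beta_*\tau_n+2\mathsf{i}\tau_n\partial_y\right)\phi_{j-n}.$$ Recursively for $j\ge1$: with $f_j=(\tau_jB_1+g_jB_2-D_j)e^{\mathsf{i}\beta_*y}$, the numbers $\tau_j,g_j$ are the (unique, real) solution of the $2\times2$ linear system $(f_j,u_* )_{L^2(\Omega)}=0$, $(f_j,v_* )_{L^2(\Omega)}=0$; and $\phi_j$ is the solution of $\mathcal{L}_*\phi_j=\tau_jB_1+g_jB_2-D_j$ in $\Omega$, with $\phi_j$ and $\partial_y\phi_j$ taking equal values at $y=L/2$ and $y=-L/2$, $\phi_j\to0$ as $z\to\pm\infty$, and $(\phi_j,\phi_* )_{L^2(\Omega)}=0$. (Such sequences exist, and there is a constant $C$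 independent of $j$ with $\|\phi_j\|_{H^1(\Omega)}\le C\|D_j\|_{L^2(\Omega)}$ for all $j\ge1$.) *)

(* Defs.v *)
From mathcomp Require Import all_boot all_order all_algebra.
From mathcomp Require Import all_classical all_reals all_analysis.
From mathcomp Require Export complex.

Set Implicit Arguments.
Unset Strict Implicit.
Unset Printing Implicit Defensive.

Import Order.TTheory GRing.Theory Num.Theory.
Import numFieldNormedType.Exports.

Local Open Scope classical_set_scope.
Local Open Scope ring_scope.
Local Open Scope complex_scope.

(* Points of the plane are pairs r = (y, z), i.e. y = r.1 and z = r.2. *)

Definition strip {R : realType} (L : R) : set (R * R) :=
  [set r | `|r.1| < L / 2].

Definition leb2 (R : realType) :
    set (measurableTypeR R * measurableTypeR R) -> \bar R :=
  (@lebesgue_measure R \x @lebesgue_measure R)%E.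

(* The imaginary unit, explicitly: in [ring_scope], 'i is an abstract square
   root of -1 of a closed field. *)
Definition ci {R : realType} : R[i] := 0 +i* 1.

(* e^{i t} *)
Definition expi {R : realType} (t : R) : R[i] := cos t +i* sin t.

(** Complex Lebesgue integrals and L^2 spaces *)

Definition cintegrable {R : realType} (A : set (R * R)) (f : R * R -> R[i]) :
    Prop :=
  (@leb2 R).-integrable A (fun r => (complex.Re (f r))%:E) /\
  (@leb2 R).-integrable A (fun r => (complex.Im (f r))%:E).

Definition cint {R : realType} (A : set (R * R)) (f : R * R -> R[i]) : R[i] :=
  (\int[@leb2 R]_(r in A) complex.Re (f r))
    +i* (\int[@leb2 R]_(r in A) complex.Im (f r)).

Definition ip {R : realType} (L : R) (f g : R * R -> R[i]) : R[i] :=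
  cint (strip L) (fun r => f r * conjc (g r)).

(* The two functions need not both be in L^2 (the diffraction solution is not),
   so that the existence of the integral defining [ip L f g] is kept as a
   separate requirement. *)
Definition ip_defined {R : realType} (L : R) (f g : R * R -> R[i]) : Prop :=
  cintegrable (strip L) (fun r => f r * conjc (g r)).

Definition orthogonal {R : realType} (L : R) (f g : R * R -> R[i]) : Prop :=
  ip_defined L f g /\ ip L f g = 0.

Definition L2 {R : realType} (A : set (R * R)) (f : R * R -> R[i]) : Prop :=
  [/\ measurable_fun (A : set (measurableTypeR R * measurableTypeR R))
        (fun r => complex.Re (f r)),
      measurable_fun (A : set (measurableTypeR R * measurableTypeR R))
        (fun r => complex.Im (f r)) &
      (\int[@leb2 R]_(r in A) ((ComplexField.Normc.normc (f r)) ^+ 2)%:E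
        < +oo)%E].

Definition L2loc {R : realType} (U : set (R * R)) (f : R * R -> R[i]) : Prop :=
  forall K : set (R * R), compact K -> K `<=` U -> L2 K f.

Definition L2norm {R : realType} (L : R) (f : R * R -> R[i]) : R :=
  Num.sqrt
    (\int[@leb2 R]_(r in strip L) (ComplexField.Normc.normc (f r)) ^+ 2).

(** Sobolev functions *)

(* A function together with candidates for its two first-order partial
   derivatives; [weak_grad] states that these are its weak derivatives. *)
Record jet (R : realType) := Jet {
  fval : R * R -> R[i];
  fdy : R * R -> R[i];
  fdz : R * R -> R[i] }.

(* Real test functions of class C^1 with compact support in U.  For locally
   square integrable data they define the same weak derivatives and the same
   weak solutions of second-order equations as C^oo functions. *)
Definition test_fun {R : realType} (U : set (R * R)) (psi : R * R -> R) :
    Prop :=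
  [/\ forall r, derivable psi r ((1, 0) : R * R)
                /\ derivable psi r ((0, 1) : R * R),
      continuous ('D_((1, 0) : R * R) psi),
      continuous ('D_((0, 1) : R * R) psi) &
      exists K : set (R * R),
        [/\ compact K, K `<=` U & forall r, ~ K r -> psi r = 0]].

Definition weak_grad {R : realType} (U : set (R * R)) (w : jet R) : Prop :=
  forall psi, test_fun U psi ->
    cint U (fun r => fval w r * ('D_((1, 0) : R * R) psi r)%:C)
      = - cint U (fun r => fdy w r * (psi r)%:C) /\
    cint U (fun r => fval w r * ('D_((0, 1) : R * R) psi r)%:C)
      = - cint U (fun r => fdz w r * (psi r)%:C).

Definition H1 {R : realType} (L : R) (w : jet R) : Prop :=
  [/\ L2 (strip L) (fval w), L2 (strip L) (fdy w), L2 (strip L) (fdz w) &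
      weak_grad (strip L) w].

Definition H1loc {R : realType} (w : jet R) : Prop :=
  [/\ L2loc setT (fval w), L2loc setT (fdy w), L2loc setT (fdz w) &
      weak_grad setT w].

Definition H1norm {R : realType} (L : R) (w : jet R) : R :=
  Num.sqrt ((L2norm L (fval w)) ^+ 2 + (L2norm L (fdy w)) ^+ 2
            + (L2norm L (fdz w)) ^+ 2).

Definition jet_sub {R : realType} (v w : jet R) : jet R :=
  Jet (fun r => fval v r - fval w r) (fun r => fdy v r - fdy w r)
      (fun r => fdz v r - fdz w r).

(* The partial sum \sum_(j < n) delta^j phi_j. *)
Definition jet_psum {R : realType} (delta : R) (phi : nat -> jet R) (n : nat) :
    jet R :=
  Jet (fun r => \sum_(j < n) (delta ^+ j)%:C * fval (phi j) r)
      (fun r => \sum_(j < n) (delta ^+ j)%:C * fdy (phi j) r)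
      (fun r => \sum_(j < n) (delta ^+ j)%:C * fdz (phi j) r).

(* The function w e^{i b y}, with its derivatives given by the product rule. *)
Definition phase {R : realType} (b : R) (w : jet R) : jet R :=
  Jet (fun r => fval w r * expi (b * r.1))
      (fun r => (fdy w r + ci * b%:C * fval w r) * expi (b * r.1))
      (fun r => fdz w r * expi (b * r.1)).

(** Quasi-periodic weak solutions *)

(* A function on the strip with u(L/2,z) = e^{i beta L} u(-L/2,z) is identified
   with its quasi-periodic extension to the plane. *)
Definition quasiperiodic {R : realType} (L beta : R) (u : R * R -> R[i]) :
    Prop :=
  forall y z, u (y + L, z) = expi (beta * L) * u (y, z).

(* Delta w + a d_y w + c w = h in the weak sense on the plane.  When w (in
   [H1loc]) is quasi-periodic, a is constant, c is L-periodic and h is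
   quasi-periodic with the same beta, this is the equation in the strip
   together with the matching at y = -L/2, L/2 of the traces of w (because w
   has a locally square integrable weak gradient across these lines) and of
   d_y w (because the equation holds across them). *)
Definition weak_solution {R : realType} (w : jet R) (a : R[i])
    (c h : R * R -> R[i]) : Prop :=
  forall psi, test_fun setT psi ->
    cint setT (fun r =>
       - (fdy w r * ('D_((1, 0) : R * R) psi r)%:C
          + fdz w r * ('D_((0, 1) : R * R) psi r)%:C)
       + (a * fdy w r + c r * fval w r) * (psi r)%:C)
    = cint setT (fun r => h r * (psi r)%:C).

Definition helmholtz {R : realType} (k : R) (eps : R * R -> R) (w : jet R) :
    Prop :=
  weak_solution w 0 (fun r => (k ^+ 2 * eps r)%:C) (fun=> 0).

Definition vanishes_at_infinity {R : realType} (L : R) (u : R * R -> R[i]) :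
    Prop :=
  forall y, `|y| < L / 2 ->
    ComplexField.Normc.normc (u (y, z)) @[z --> +oo] --> (0 : R) /\
    ComplexField.Normc.normc (u (y, z)) @[z --> -oo] --> (0 : R).

(** Dielectric functions *)

Definition Linfty {R : realType} (f : R * R -> R) : Prop :=
  measurable_fun (setT : set (measurableTypeR R * measurableTypeR R)) f /\
  exists M : R, {ae @leb2 R, forall r, `|f r| <= M}.

Definition y_periodic {R : realType} (L : R) (f : R * R -> R) : Prop :=
  forall y z, f (y + L, z) = f (y, z).

Definition even_in_both {R : realType} (f : R * R -> R) : Prop :=
  forall y z, f (- y, z) = f (y, z) /\ f (y, - z) = f (y, z).

Definition symmetric_dielectric {R : realType} (L d : R) (eps : R * R -> R) :
    Prop :=
  [/\ Linfty eps, forall r, 0 < eps r, y_periodic L eps, even_in_both eps &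
      forall r, d < `|r.2| -> eps r = 1].

Definition symmetric_perturbation {R : realType} (L d : R) (F : R * R -> R) :
    Prop :=
  [/\ Linfty F, y_periodic L F, even_in_both F &
      forall r, d < `|r.2| -> F r = 0].

(** Bound states in the continuum *)

Definition bound_mode {R : realType} (L : R) (eps : R * R -> R) (beta k : R)
    (u : jet R) : Prop :=
  [/\ H1loc u, H1 L u, quasiperiodic L beta (fval u), helmholtz k eps u &
      vanishes_at_infinity L (fval u)].

Definition BIC {R : realType} (L : R) (eps : R * R -> R) (beta k : R)
    (u : jet R) : Prop :=
  [/\ - (pi / L) < beta <= pi / L, `|beta| < k, bound_mode L eps beta k u &
      ~ {ae @leb2 R, forall r, fval u r = 0}].

Definition nondegenerate {R : realType} (L : R) (eps : R * R -> R)
    (beta k : R) (u : jet R) : Prop :=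
  forall w, bound_mode L eps beta k w ->
    exists c : R[i], {ae @leb2 R, forall r, fval w r = c * fval u r}.

Definition y_conj_symmetric {R : realType} (u : R * R -> R[i]) : Prop :=
  forall y z, u (y, z) = conjc (u (- y, z)).

Definition z_parity {R : realType} (sigma : R) (u : R * R -> R[i]) : Prop :=
  forall y z, u (y, - z) = sigma%:C * u (y, z).

(** Diffraction solution *)

Definition beta_ {R : realType} (L beta : R) (m : int) : R :=
  beta + 2 * pi * m%:~R / L.

Definition alpha0 {R : realType} (beta k : R) : R :=
  Num.sqrt (k ^+ 2 - beta ^+ 2).

Definition gamma_ {R : realType} (L beta k : R) (m : int) : R :=
  Num.sqrt ((beta_ L beta m) ^+ 2 - k ^+ 2).

Definition propagating_part {R : realType} (beta k theta : R) (r : R * R) :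
    R[i] :=
  expi (- theta) * expi (beta * r.1 - alpha0 beta k * r.2)
  + expi theta * expi (beta * r.1 + alpha0 beta k * r.2).

Definition evanescent_wave {R : realType} (L beta k : R) (m : int)
    (r : R * R) : R[i] :=
  expi (beta_ L beta m * r.1) * (expR (- (gamma_ L beta k m * r.2)))%:C.

Definition evanescent_psum {R : realType} (L beta k : R) (b : int -> R[i])
    (N : nat) (r : R * R) : R[i] :=
  \sum_(1 <= m < N.+1)
    (b (m%:Z) * evanescent_wave L beta k (m%:Z) r
     + b (- (m%:Z)) * evanescent_wave L beta k (- (m%:Z)) r).

Definition diffraction_expansion {R : realType} (L d beta k : R)
    (v : R * R -> R[i]) : Prop :=
  exists (theta : R) (b : int -> R[i]),
    forall r : R * R, d < r.2 ->
      ComplexField.Normc.normc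
        (v r - (propagating_part beta k theta r
                + evanescent_psum L beta k b N r)) @[N --> \oo] --> (0 : R).

Definition diffraction_solution {R : realType} (L d : R) (eps : R * R -> R)
    (beta k sigma : R) (u v : jet R) : Prop :=
  [/\ H1loc v, quasiperiodic L beta (fval v) & helmholtz k eps v] /\
  [/\ z_parity sigma (fval v), diffraction_expansion L d beta k (fval v),
      y_conj_symmetric (fval v) &
      orthogonal L (fun r => (eps r)%:C * fval u r) (fval v)].

Definition reference_BIC {R : realType} (L d : R) (eps : R * R -> R)
    (beta k : R) (u v : jet R) : Prop :=
  [/\ BIC L eps beta k u, nondegenerate L eps beta k u,
      `|beta| < k < 2 * pi / L - `|beta|,
      y_conj_symmetric (fval u) & L2norm L (fval u) = 1] /\
  exists sigma : R,
    [/\ sigma = 1 \/ sigma = -1, z_parity sigma (fval u),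
        diffraction_solution L d eps beta k sigma u v,
        ip_defined L (fdy u) (fval v) & ip L (fdy u) (fval v) <> 0].

(** The perturbation sequences *)

Definition B1 {R : realType} (beta : R) (phi0 : jet R) (r : R * R) : R[i] :=
  2 * (beta%:C * fval phi0 r - ci * fdy phi0 r).

Definition B2 {R : realType} (eps : R * R -> R) (phi0 : jet R) (r : R * R) :
    R[i] :=
  - ((eps r)%:C * fval phi0 r).

Definition Dseq {R : realType} (eps F : R * R -> R) (beta : R)
    (phi : nat -> jet R) (tau g : nat -> R) (j : nat) (r : R * R) : R[i] :=
  \sum_(1 <= n < j.+1) (g n.-1 * F r)%:C * fval (phi (j - n)%N) r
  - \sum_(2 <= n < j.+1) \sum_(1 <= m < n)
      (tau m * tau (n - m)%N)%:C * fval (phi (j - n)%N) r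
  + \sum_(1 <= n < j)
      ((g n * eps r - 2 * beta * tau n)%:C * fval (phi (j - n)%N) r
       + 2 * ci * (tau n)%:C * fdy (phi (j - n)%N) r).

Definition rhs {R : realType} (eps F : R * R -> R) (beta : R)
    (phi : nat -> jet R) (tau g : nat -> R) (j : nat) (r : R * R) : R[i] :=
  (tau j)%:C * B1 beta (phi 0%N) r + (g j)%:C * B2 eps (phi 0%N) r
  - Dseq eps F beta phi tau g j r.

Definition fseq {R : realType} (eps F : R * R -> R) (beta : R)
    (phi : nat -> jet R) (tau g : nat -> R) (j : nat) (r : R * R) : R[i] :=
  rhs eps F beta phi tau g j r * expi (beta * r.1).

(* L_* w = h, with L_* = Delta + 2 i beta d_y + k^2 eps - beta^2 *)
Definition Lstar_solution {R : realType} (eps : R * R -> R) (beta k : R)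
    (w : jet R) (h : R * R -> R[i]) : Prop :=
  weak_solution w (2 * ci * beta%:C)
    (fun r => (k ^+ 2 * eps r - beta ^+ 2)%:C) h.

Definition perturbation_sequences {R : realType} (L : R) (eps F : R * R -> R)
    (beta k : R) (u v : jet R) (phi : nat -> jet R) (tau g : nat -> R) :
    Prop :=
  [/\ phi 0%N = phase (- beta) u, tau 0%N = beta & g 0%N = k ^+ 2] /\
  forall j : nat, (1 <= j)%N ->
    [/\ orthogonal L (fseq eps F beta phi tau g j) (fval u) &
        orthogonal L (fseq eps F beta phi tau g j) (fval v)] /\
    [/\ H1loc (phi j) /\ H1 L (phi j),
        quasiperiodic L 0 (fval (phi j)),
        Lstar_solution eps beta k (phi j) (rhs eps F beta phi tau g j),
        vanishes_at_infinity L (fval (phi j)) &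
        orthogonal L (fval (phi j)) (fval (phi 0%N))].

Definition H1_estimate {R : realType} (L : R) (eps F : R * R -> R) (beta : R)
    (phi : nat -> jet R) (tau g : nat -> R) : Prop :=
  exists C : R, forall j : nat, (1 <= j)%N ->
    H1norm L (phi j) <= C * L2norm L (Dseq eps F beta phi tau g j).

Definition H1_convergent {R : realType} (L : R) (s : nat -> jet R) : Prop :=
  exists Phi : jet R,
    H1 L Phi /\ H1norm L (jet_sub (s n) Phi) @[n --> \oo] --> (0 : R).

(* Main.v *)
Require Import Defs.
From mathcomp Require Import all_boot all_order all_algebra.
From mathcomp Require Import all_classical all_reals all_analysis.
From mathcomp Require Import measurable_realfun ring lra zify.

(** The coefficients satisfy a polynomial recurrence: if
    X_j = ||phi_j||_{H^1} + |tau_j| + |g_j|, then X_j is at most a constant times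
    the Cauchy-product sums that make up ||D_j||, in which only X_0, ...,
    X_{j-1} occur.  Such a recurrence forces geometric growth at most
    ([cubic_recurrence_summable]), so the three series converge absolutely near
    delta = 0.

    The bound of phi_j by D_j is the given H^1 estimate.  The diffraction solution
    is not square integrable, so that its pairing with D_j is not directly
    controlled by ||D_j||; the bound of tau_j and g_j by D_j is instead read off
    the equation L_* phi_j = tau_j B_1 + g_j B_2 - D_j.  Tested against a fixed C^1
    function psi supported in the strip, it expresses
    tau_j <B_1, psi> + g_j <B_2, psi> through <D_j, psi> and through phi_j and
    its gradient, hence through ||D_j||.  Two test functions psi_1, psi_2 with
    det (<B_i, psi_k>) <> 0 then determine tau_j and g_j by Cramer's rule
    ([coefficient_bound]).

    Such test functions exist as soon as B_1 and B_2 are linearly independent on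
    the strip ([separating_tests], by the lemma of du Bois-Reymond), and here the
    diffraction solution v enters: up to the phase e^{-i beta y}, B_1 is
    -2i d_y u and B_2 is -eps u; the pairing with v annihilates eps u but not
    d_y u, and u is not zero ([BIC_tests]).

    The sum of the phi_j is constructed by completeness of L^2, applied to phi_j
    and to both of its weak derivatives; since integration by parts against a
    test function is continuous in L^2, the limits form an H^1 function
    ([H1_series_cvg]).  For j = 0 the membership in H^1 of phi_0 = u e^{-i beta y}
    is the product rule [H1_phase]. *)

Set Implicit Arguments.
Unset Strict Implicit.
Unset Printing Implicit Defensive.
Import Order.TTheory GRing.Theory Num.Theory.
Import numFieldNormedType.Exports.

Local Open Scope classical_set_scope.
Local Open Scope ring_scope.
Local Open Scope complex_scope.

Local Notation Re := complex.Re.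
Local Notation Im := complex.Im.
Local Notation normc := ComplexField.Normc.normc.

(** * Square integrable real functions *)
Section SquareIntegrable.
Context d (T : measurableType d) (R : realType).
Variables (mu : {measure set T -> \bar R}) (D : set T).
Hypothesis mD : measurable D.
Implicit Types f g h : T -> R.

Definition sqint (f : T -> R) : Prop :=
  measurable_fun D f /\ (\int[mu]_(x in D) ((f x) ^+ 2)%:E < +oo)%E.

Definition sqnorm (f : T -> R) : R := Num.sqrt (\int[mu]_(x in D) (f x) ^+ 2).

Lemma sqnorm_ge0 f : 0 <= sqnorm f.
Proof. exact: sqrtr_ge0. Qed.

Lemma sqr_sqnorm f : sqnorm f ^+ 2 = \int[mu]_(x in D) (f x) ^+ 2.
Proof. by rewrite sqr_sqrtr// Rintegral_ge0// => x _; exact: sqr_ge0. Qed.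

Lemma sqint_integrable f : sqint f ->
  mu.-integrable D (EFin \o (fun x => (f x) ^+ 2)).
Proof.
case=> mf fi; apply/integrableP; split.
  by apply/measurable_EFinP; exact: measurable_funX.
by under eq_integral do rewrite /= ger0_norm ?sqr_ge0//.
Qed.

Lemma integrable_sqint f : measurable_fun D f ->
  mu.-integrable D (EFin \o (fun x => (f x) ^+ 2)) -> sqint f.
Proof.
move=> mf /integrableP[_ fi]; split => //.
by move: fi; under eq_integral do rewrite /= ger0_norm ?sqr_ge0//.
Qed.

(** Pointwise, |f g| <= f^2 + g^2. *)
Lemma sqint_integrableM f g : sqint f -> sqint g ->
  mu.-integrable D (EFin \o (fun x => f x * g x)).
Proof.
move=> Hf Hg; have [mf _] := Hf; have [mg _] := Hg.
apply: (@le_integrable _ _ _ _ _ mD _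
  (EFin \o (fun x => (f x) ^+ 2 + (g x) ^+ 2))).
- by apply/measurable_EFinP; exact: measurable_funM.
- move=> x _ /=; rewrite lee_fin [leRHS]ger0_norm ?addr_ge0 ?sqr_ge0//.
  by rewrite ler_norml; apply/andP; split; nra.
- have -> : EFin \o (fun x => (f x) ^+ 2 + (g x) ^+ 2) =
     ((EFin \o (fun x => (f x) ^+ 2)%R) \+ (EFin \o (fun x => (g x) ^+ 2)%R))%E by [].
  by apply: integrableD => //; exact: sqint_integrable.
Qed.

Lemma sqint_le f g : measurable_fun D f -> sqint g ->
  {ae mu, forall x, D x -> `|f x| <= `|g x|} -> sqint f /\ sqnorm f <= sqnorm g.
Proof.
move=> mf [mg gi] fg.
have le : (\int[mu]_(x in D) ((f x) ^+ 2)%:E <=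
           \int[mu]_(x in D) ((g x) ^+ 2)%:E)%E.
  apply: ae_ge0_le_integral => //.
  - by move=> x _; rewrite lee_fin sqr_ge0.
  - by apply/measurable_EFinP; exact: measurable_funX.
  - by move=> x _; rewrite lee_fin sqr_ge0.
  - by apply/measurable_EFinP; exact: measurable_funX.
  - apply: filterS fg => x /[apply] h; rewrite lee_fin.
    by rewrite -[leLHS]real_normK ?num_real// -[leRHS]real_normK ?num_real//;
       rewrite ler_sqr ?nnegrE.
have fi := le_lt_trans le gi.
split=> //; rewrite /sqnorm ler_wsqrtr// /Rintegral fine_le//.
  by rewrite ge0_fin_numE//; apply: integral_ge0 => x _; rewrite lee_fin sqr_ge0.
by rewrite ge0_fin_numE//; apply: integral_ge0 => x _; rewrite lee_fin sqr_ge0.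
Qed.

Lemma sqintZ c f : sqint f ->
  sqint (fun x => c * f x) /\ sqnorm (fun x => c * f x) = `|c| * sqnorm f.
Proof.
move=> Hf; have [mf fi] := Hf.
have E : EFin \o (fun x => (c * f x) ^+ 2) =
         (fun x => (c ^+ 2)%:E * ((f x) ^+ 2)%:E)%E.
  by apply/funext => x /=; rewrite exprMn EFinM.
split.
  apply: integrable_sqint; first exact: measurable_funM.
  by rewrite E; apply: integrableZl => //; exact: sqint_integrable.
rewrite /sqnorm; under eq_Rintegral do rewrite exprMn.
rewrite RintegralZl//; last exact: sqint_integrable.
by rewrite sqrtrM ?sqr_ge0// sqrtr_sqr.
Qed.

Lemma sqint_abs f : sqint f ->
  sqint (fun x => `|f x|) /\ sqnorm (fun x => `|f x|) = sqnorm f.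
Proof.
case=> mf fi; split.
  split; first exact: measurableT_comp.
  by under eq_integral do rewrite real_normK ?num_real//.
by rewrite /sqnorm; under eq_Rintegral do rewrite real_normK ?num_real//.
Qed.

(** The polynomial ||f - t g||^2 = a^2 - 2 t c + t^2 b^2 in t is nonnegative; its
    minimum, for b <> 0 attained at t = c / b^2, is a^2 - c^2 / b^2. *)
Lemma sqint_cauchy_schwarz f g : sqint f -> sqint g ->
  `|\int[mu]_(x in D) (f x * g x)| <= sqnorm f * sqnorm g.
Proof.
move=> Hf Hg.
set a := sqnorm f; set b := sqnorm g; set c := \int[mu]_(x in D) (f x * g x).
have q t : 0 <= a ^+ 2 - 2 * t * c + t ^+ 2 * b ^+ 2.
  rewrite !sqr_sqnorm /c.
  have -> : \int[mu]_(x in D) (f x) ^+ 2 - 2 * t * \int[mu]_(x in D) (f x * g x)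
     + t ^+ 2 * \int[mu]_(x in D) (g x) ^+ 2 =
     \int[mu]_(x in D) ((f x - t * g x) ^+ 2).
    rewrite -RintegralZl//; last exact: sqint_integrableM.
    rewrite -RintegralZl//; last exact: sqint_integrable.
    rewrite -RintegralB//; first last.
    - have := @integrableZl _ _ _ _ _ mD (2 * t) _ (sqint_integrableM Hf Hg).
      exact.
    - exact: sqint_integrable.
    rewrite -RintegralD//; first last.
    - have := @integrableZl _ _ _ _ _ mD (t ^+ 2) _ (sqint_integrable Hg).
      exact.
    - have := @integrableZl _ _ _ _ _ mD (2 * t) _ (sqint_integrableM Hf Hg).
      by move=> i; have := integrableB mD (sqint_integrable Hf) i; exact.
    by apply: eq_Rintegral => x _; ring.
  by apply: Rintegral_ge0 => x _; exact: sqr_ge0.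
have a0 : 0 <= a := sqnorm_ge0 _; have b0 : 0 <= b := sqnorm_ge0 _.
suff : c ^+ 2 <= (a * b) ^+ 2.
  rewrite -[c ^+ 2]real_normK ?num_real// ler_sqr ?nnegrE// mulr_ge0//.
have [b00|bn0] := eqVneq b 0.
  (* if b = 0 and c <> 0, this t makes the affine polynomial equal to -1 *)
  have q1 := q ((a ^+ 2 + 1) / (2 * c)).
  have [->|cn0] := eqVneq c 0; first by rewrite expr0n/= sqr_ge0.
  move: q1; rewrite b00 expr0n/= !mulr0 addr0.
  have -> : 2 * ((a ^+ 2 + 1) / (2 * c)) * c = a ^+ 2 + 1.
    by field; rewrite cn0.
  by lra.
have := q (c / b ^+ 2).
have -> : a ^+ 2 - 2 * (c / b ^+ 2) * c + (c / b ^+ 2) ^+ 2 * b ^+ 2 =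
   ((a * b) ^+ 2 - c ^+ 2) / b ^+ 2.
  by field; rewrite bn0.
by rewrite pmulr_lge0 ?subr_ge0// invr_gt0 exprn_gt0// lt0r bn0.
Qed.

Lemma sqintD f g : sqint f -> sqint g -> sqint (fun x => f x + g x).
Proof.
move=> Hf Hg; have [mf _] := Hf; have [mg _] := Hg.
apply: integrable_sqint; first exact: measurable_funD.
have -> : EFin \o (fun x => (f x + g x) ^+ 2) =
  ((EFin \o (fun x => (f x) ^+ 2)%R) \+ ((fun x => 2%:E * ((f x) * (g x))%:E) \+
   (EFin \o (fun x => (g x) ^+ 2)%R)))%E.
  by apply/funext => x /=; rewrite -EFinM -!EFinD; congr EFin; ring.
apply: integrableD => //; first exact: sqint_integrable.
apply: integrableD => //; last exact: sqint_integrable.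
by apply: integrableZl => //; exact: sqint_integrableM.
Qed.

Lemma sqnormD f g : sqint f -> sqint g ->
  sqnorm (fun x => f x + g x) <= sqnorm f + sqnorm g.
Proof.
move=> Hf Hg.
have ab : 0 <= sqnorm f + sqnorm g by rewrite addr_ge0// sqnorm_ge0.
rewrite -(ler_sqr (sqnorm_ge0 _))// ?nnegrE// sqr_sqnorm.
have -> : \int[mu]_(x in D) (f x + g x) ^+ 2 =
  sqnorm f ^+ 2 + (2 * \int[mu]_(x in D) (f x * g x) + sqnorm g ^+ 2).
  rewrite !sqr_sqnorm -RintegralZl//; last exact: sqint_integrableM.
  have i2 := @integrableZl _ _ _ _ _ mD 2 _ (sqint_integrableM Hf Hg).
  rewrite -RintegralD//; last exact: sqint_integrable.
  rewrite -RintegralD//; first by apply: eq_Rintegral => x _; ring.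
    exact: sqint_integrable.
  have : mu.-integrable D ((fun x => 2%:E * ((f x) * (g x))%:E) \+
   (EFin \o (fun x => (g x) ^+ 2)%R))%E.
    by apply: integrableD => //; exact: sqint_integrable.
  exact.
have := sqint_cauchy_schwarz Hf Hg; rewrite ler_norml => /andP[_]; nra.
Qed.

Lemma sqint0 : sqint (fun=> 0) /\ sqnorm (fun=> 0) = 0.
Proof.
split; first split => //.
  by under eq_integral do rewrite expr0n/=; rewrite integral0 ltry.
rewrite /sqnorm; under eq_Rintegral do rewrite expr0n/=.
by rewrite /Rintegral integral0 sqrtr0.
Qed.

Lemma sqint_sum (f : nat -> T -> R) n : (forall i, sqint (f i)) ->
  sqint (fun x => \sum_(i < n) f i x) /\
  sqnorm (fun x => \sum_(i < n) f i x) <= \sum_(i < n) sqnorm (f i).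
Proof.
move=> Hf; elim: n => [|n [IH1 IH2]].
  have -> : (fun x => \sum_(i < 0) f i x) = fun=> 0.
    by apply/funext => x; rewrite big_ord0.
  by have [? ->] := sqint0; rewrite big_ord0.
have -> : (fun x => \sum_(i < n.+1) f i x) =
          (fun x => \sum_(i < n) f i x + f n x).
  by apply/funext => x; rewrite big_ord_recr.
split; first exact: sqintD.
rewrite big_ord_recr/=; apply: (le_trans (sqnormD IH1 (Hf n))).
by rewrite lerD2r.
Qed.

Lemma cvg_sqnorm0 (h : nat -> T -> R) :
  (\int[mu]_(x in D) ((h n x) ^+ 2)%:E @[n --> \oo] --> 0)%E ->
  sqnorm (h n) @[n --> \oo] --> 0.
Proof.
move=> h0; rewrite -sqrtr0.
apply: (@cvg_comp _ _ _ _ (@Num.sqrt R) _ (nbhs (0:R))); last exact: sqrt_continuous.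
have := @fine_cvg _ _ _ _ _ _ h0.
exact.
Qed.

(** Completeness of L^2.  The sums G_n of the |f_i| are bounded in L^2, so by
    monotone convergence the limit Gi of the G_n^2 is integrable, hence finite
    almost everywhere.  There the series converges absolutely, and Gi dominates
    the squared remainders, which therefore tend to 0 in L^1. *)
Lemma sqint_series_cvg (f : nat -> T -> R) (A : R) : (forall n, sqint (f n)) ->
  (forall N, \sum_(n < N) sqnorm (f n) <= A) ->
  exists g, sqint g /\
    sqnorm (fun x => \sum_(i < n) f i x - g x) @[n --> \oo] --> 0.
Proof.
move=> Hf HA.
pose S n x : R := \sum_(i < n) f i x.
pose G n x : R := \sum_(i < n) `|f i x|.
have HG n : sqint (G n) /\ sqnorm (G n) <= A.
  have [|h1 h2] := @sqint_sum (fun i x => `|f i x|) n.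
    by move=> i; have [] := sqint_abs (Hf i).
  split => //; apply: (le_trans h2); apply: le_trans (HA n).
  by apply: ler_sum => i _; have [_ ->] := sqint_abs (Hf i).
have ndG x n m : (n <= m)%N -> (G n x) <= (G m x).
  move=> nm; rewrite /G -!(big_mkord xpredT (fun i => `|f i x|)).
  by rewrite (big_cat_nat (leq0n n) nm)//= lerDl sumr_ge0.
have G0 n x : 0 <= G n x by apply: sumr_ge0.
pose Gi x : \bar R := limn (fun n => ((G n x) ^+ 2)%:E)%E.
have ndG2 x : {homo (fun n => ((G n x) ^+ 2)%:E)%E : n m / (n <= m)%N >-> (n <= m)%E}.
  by move=> n m nm; rewrite lee_fin ler_sqr ?nnegrE ?ndG.
have mG2 n : measurable_fun D (fun x => ((G n x) ^+ 2)%:E).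
  by apply/measurable_EFinP/measurable_funX; have [[]] := HG n.
have A0 : 0 <= A by have := HA 0%N; rewrite big_ord0.
have cG x : ((G n x) ^+ 2)%:E @[n --> \oo] --> Gi x.
  by apply: ereal_nondecreasing_is_cvgn; exact: ndG2.
have leGi x n : (((G n x) ^+ 2)%:E <= Gi x)%E.
  rewrite /Gi; apply: (@lime_ge _ _ _ _ ((G n x) ^+ 2)%:E).
    by apply: ereal_nondecreasing_is_cvgn; exact: ndG2.
  by near=> m; apply: ndG2; near: m; exact: nbhs_infty_ge.
have Gi0 x : (0 <= Gi x)%E.
  by apply: le_trans (leGi x 0%N); rewrite lee_fin sqr_ge0.
have mGi : measurable_fun D Gi.
  by apply: (@emeasurable_fun_cvg _ _ _ _ (fun n x => ((G n x) ^+ 2)%:E)).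
have iGi : mu.-integrable D Gi.
  apply/integrableP; split => //.
  under eq_integral do rewrite gee0_abs//.
  rewrite /Gi monotone_convergence//; last first.
    by move=> n x _; rewrite lee_fin sqr_ge0.
  apply: (@le_lt_trans _ _ (A ^+ 2)%:E); last exact: ltry.
  apply: lime_le.
    apply: ereal_nondecreasing_is_cvgn => n m nm; apply: ge0_le_integral => //.
    - by move=> x _; rewrite lee_fin sqr_ge0.
    - by move=> x _; exact: ndG2.
  apply: nearW => n; have [[? fin] le] := HG n.
  have -> : (\int[mu]_(x in D) ((G n x) ^+ 2)%:E =
             (\int[mu]_(x in D) ((G n x) ^+ 2))%:E)%E.
    rewrite fineK// ge0_fin_numE//; apply: integral_ge0 => x _.
    by rewrite lee_fin sqr_ge0.
  by rewrite lee_fin -sqr_sqnorm ler_sqr// ?nnegrE// sqnorm_ge0.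
have aeG : {ae mu, forall x, D x -> Gi x \is a fin_num} by exact: integrable_ae.
pose E := D `&` [set x | Gi x \is a fin_num].
have mE : measurable E by exact: emeasurable_fin_num.
(* outside E the series is replaced by 0, so that it converges everywhere *)
pose h n x := S n x * \1_E x.
have cS x : Gi x \is a fin_num -> cvgn (S^~ x).
  move=> fx; have -> : S^~ x = series (f^~ x).
    by apply/funext => n; rewrite /S seriesEord.
  apply: normed_cvg; apply: nondecreasing_is_cvgn.
    by apply: nondecreasing_series => n _ _; rewrite /= normr_ge0.
  exists (fine (Gi x) + 1) => _ [n _ <-]; rewrite /normed_series_of seriesEord.
  have := leGi x n; rewrite -(fineK fx) lee_fin -/(G n x) => h1.
  change (G n x <= fine (Gi x) + 1).
  have := sqr_ge0 (G n x - 1); move: h1; set q := G n x; set y := fine _; nra.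
have ch x : cvgn (h^~ x).
  rewrite /h; have [xE|xE] := boolP (x \in E).
    by apply: is_cvgMl; apply: cS; move/set_mem : xE => [].
  rewrite indicE (negbTE xE) /=.
  by under eq_fun do rewrite mulr0; exact: is_cvg_cst.
pose g x : R := limn (h^~ x).
have mS n : measurable_fun D (S n) by have [[]] := @sqint_sum f n Hf.
have mg : measurable_fun D g.
  apply: (@measurable_fun_cvg _ _ _ D h) => [n|x _]; last exact: ch.
  by apply: measurable_funM => //; exact/measurable_indic.
have cSg x : D x -> Gi x \is a fin_num -> S n x @[n --> \oo] --> g x.
  move=> Dx fx; have := ch x; rewrite -/(g x) /h.
  have -> : \1_E x = 1 :> R by rewrite indicE mem_set.
  by under eq_fun do rewrite mulr1.
have leSg x n : D x -> Gi x \is a fin_num -> (((S n x - g x) ^+ 2)%:E <= Gi x)%E.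
  move=> Dx fx; rewrite -(fineK fx) lee_fin.
  have c2 : (S n x - S m x) ^+ 2 @[m --> \oo] --> (S n x - g x) ^+ 2.
    by apply: cvgM; apply: cvgB; first [exact: cvg_cst|exact: cSg].
  rewrite -(cvg_lim _ c2)//; apply: limr_le; first by apply/cvg_ex; eexists; exact: c2.
  near=> m.
  have nm : (n <= m)%N by near: m; exact: nbhs_infty_ge.
  apply: (@le_trans _ _ ((G m x) ^+ 2)); last first.
    by rewrite -lee_fin fineK.
  rewrite -[leLHS]real_normK ?num_real// ler_sqr ?nnegrE// distrC.
  rewrite /S /G -!(big_mkord xpredT (fun i => f i x)).
  rewrite -!(big_mkord xpredT (fun i => `|f i x|)).
  rewrite (big_cat_nat (leq0n n) nm)//= [X in `|X|]addrAC subrr add0r (big_cat_nat (leq0n n) nm)//=.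
  by apply: (le_trans (ler_norm_sum _ _ _)); rewrite lerDr sumr_ge0.
exists g; split.
  split => //.
  have [_] := integrableP _ _ _ iGi; apply: le_lt_trans.
  apply: ae_ge0_le_integral => //.
  - by move=> x _; rewrite lee_fin sqr_ge0.
  - by apply/measurable_EFinP; exact: measurable_funX.
  - exact: measurableT_comp.
  - apply: filterS aeG => x Hx Dx; have := leSg x 0%N Dx (Hx Dx).
    by rewrite /S big_ord0 sub0r sqrrN gee0_abs.
apply: cvg_sqnorm0.
have [|||||_ _] := @dominated_convergence _ _ _ mu D mD
  (fun n x => ((S n x - g x) ^+ 2)%:E) (cst 0%E) Gi.
- move=> n; apply/measurable_EFinP/measurable_funX.
  exact: measurable_funB.
- exact: measurable_cst.
- apply: filterS aeG => x Hx Dx.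
  apply: cvg_EFin; first exact: nearW.
  have -> : (0 : R) = (g x - g x) ^+ 2 by rewrite subrr expr0n.
  by apply: cvgM; apply: cvgB; first [exact: cvg_cst|exact: cSg (Hx _)].
- exact: iGi.
- by apply: filterS aeG => x Hx n Dx; rewrite gee0_abs ?lee_fin ?sqr_ge0//; exact: leSg (Hx _).
by rewrite integral_cst// mul0e.
Unshelve. all: by end_near. Qed.

End SquareIntegrable.

(** * A majorant for a cubic recurrence *)
Section Majorant.
Variable R : realFieldType.
Implicit Types a b X z : nat -> R.

Definition cauchy_product a b j := \sum_(n < j.+1) a n * b (j - n)%N.

Lemma cauchy_product_ge0 a b j : (forall n, 0 <= a n) -> (forall n, 0 <= b n) ->
  0 <= cauchy_product a b j.
Proof. by move=> a0 b0; apply: sumr_ge0 => n _; rewrite mulr_ge0. Qed.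

Lemma sum_cauchy_product_le a b N : (forall n, 0 <= a n) -> (forall n, 0 <= b n) ->
  \sum_(j < N) cauchy_product a b j <= (\sum_(n < N) a n) * (\sum_(n < N) b n).
Proof.
move=> a0 b0.
have -> : \sum_(j < N) cauchy_product a b j =
    \sum_(n < N) a n * \sum_(j < N | (n <= j)%N) b (j - n)%N.
  under [RHS]eq_bigr do rewrite mulr_sumr.
  rewrite (exchange_big_dep xpredT)//=; apply: eq_bigr => j _.
  rewrite /cauchy_product (big_ord_widen N (fun n => a n * b (j - n)%N))//.
rewrite mulr_suml; apply: ler_sum => n _; rewrite ler_wpM2l//.
rewrite -(big_mkord (fun j => n <= j)%N (fun j => b (j - n)%N)).
rewrite -(big_mkord xpredT b).
rewrite (big_cat_nat (leq0n n) (ltnW (ltn_ord n)))/=.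
rewrite big_nat_cond big_pred0 ?add0r; last first.
  by move=> i; apply/negbTE; rewrite !negb_and/= -leqNgt -ltnNge; lia.
rewrite (_ : \sum_(n <= j < N | (n <= j)%N) b (j - n)%N = \sum_(0 <= i < N - n) b i).
  rewrite [leRHS](@big_cat_nat _ _ _ (N - n)%N) ?leq_subr//= lerDl.
  by apply: sumr_ge0.
rewrite -[X in \sum_(X <= _ < _ | _) _]add0n big_addn.
rewrite big_nat_cond [RHS]big_nat_cond.
by apply: eq_big => i; [rewrite leq_addl|rewrite addnK].
Qed.

Lemma sum_inner_le_cauchy_product a z N j : (j <= N)%N -> (forall n, 0 <= z n) ->
  (forall n, (1 <= n < N)%N -> a n = z n) ->
  \sum_(1 <= n < j) a n * a (j - n)%N <= cauchy_product z z j.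
Proof.
move=> jN z0 az; rewrite /cauchy_product -(big_mkord xpredT (fun n => z n * z (j - n)%N)).
case: j jN => [|j] jN.
  by rewrite [leLHS]big_geq//; apply: sumr_ge0 => i _; rewrite mulr_ge0.
rewrite [leRHS]big_nat_recr//= [X in _ <= X + _]big_ltn//=.
rewrite (@eq_big_nat _ _ _ _ _ _ (fun n => z n * z (j.+1 - n)%N)).
  set s := \sum_(1 <= _ < _) _; rewrite addrAC lerDr.
  by rewrite addr_ge0// mulr_ge0.
by move=> i ij; rewrite !az//; lia.
Qed.

(** The sums P_N of X_j rho^j over 1 <= j < N satisfy
    P_{N+1} <= K (rho (X_0 + P_N)^2 + P_N^2 (X_0 + P_N) + P_N^2), because a
    partial sum of a Cauchy product is at most the product of partial sums.
    Every term on the right is either of order at least two in P_N or has the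
    factor rho, so a small bound A on the P_N reproduces itself when rho is
    small enough. *)
Lemma cubic_recurrence_summable X (K : R) : (forall j, 0 <= X j) -> 0 <= K ->
  (forall j, (1 <= j)%N -> X j <= K *
    (\sum_(1 <= n < j.+1) X n.-1 * X (j - n)%N
     + \sum_(2 <= n < j.+1) \sum_(1 <= m < n) X m * X (n - m)%N * X (j - n)%N
     + \sum_(1 <= n < j) X n * X (j - n)%N)) ->
  exists2 rho, 0 < rho & exists A, forall N, \sum_(j < N) X j * rho ^+ j <= A.
Proof.
move=> X0 K0 HX.
pose x0 := X 0%N; have x00 : 0 <= x0 by exact: X0.
(* A makes the terms of order at least two at most A / 2, and rho the term
   with factor rho *)
pose A := ((K + 1) * (x0 + 2) * 2)^-1.
have D0 : 0 < (K + 1) * (x0 + 2) * 2 by nra.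
have A0 : 0 < A by rewrite invr_gt0.
have AE : A * ((K + 1) * (x0 + 2) * 2) = 1 by rewrite mulVf// gt_eqF.
have A1 : A <= 1 by rewrite invf_le1//; nra.
pose rho := A / ((K + 1) * (x0 + 1) ^+ 2 * 2).
have D1 : 0 < (K + 1) * (x0 + 1) ^+ 2 * 2.
  by rewrite !mulr_gt0// ?exprn_gt0//; lra.
have rho0 : 0 < rho by rewrite divr_gt0.
have rhoE : rho * ((K + 1) * (x0 + 1) ^+ 2 * 2) = A by rewrite divfK// gt_eqF.
exists rho => //; exists (x0 + A) => N.
pose W j := X j * rho ^+ j.
have W0 j : 0 <= W j by rewrite mulr_ge0// exprn_ge0// ltW.
have WW n m : X n * X m * rho ^+ (n + m) = W n * W m by rewrite /W exprD; ring.
suff PA n : \sum_(1 <= j < n) W j <= A.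
  case: N => [|N]; first by rewrite big_ord0; nra.
  rewrite -(big_mkord xpredT W) big_ltn// {1}/W expr0 mulr1 lerD2l//.
elim: n {N} => [|N IH]; first by rewrite big_geq// ltW.
set P := \sum_(1 <= j < N) W j in IH.
have P0 : 0 <= P by apply: sumr_ge0.
(* truncations at N: the terms of index j <= N of the second and third sums
   involve only indices smaller than N *)
pose z n := if (1 <= n < N)%N then W n else 0.
pose y n := if (n < N)%N then W n else 0.
have z0 n : 0 <= z n by rewrite /z; case: ifP.
have y0 n : 0 <= y n by rewrite /y; case: ifP.
have sz : \sum_(n < N.+1) z n = P.
  rewrite -(big_mkord xpredT z) big_ltn//= {1}/z/= add0r.
  case: N @P @z @y {IH P0 z0 y0} => [|N] P z y.
    by rewrite big_geq// /P big_geq.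
  rewrite big_nat_recr//= {2}/z ltnn andbF addr0.
  by apply: eq_big_nat => i; rewrite /z => ->.
have sy : \sum_(n < N.+1) y n <= x0 + P.
  case: N @P @z @y {IH P0 z0 y0 sz} => [|N] P z y.
    by rewrite big_ord_recl big_ord0 /y/= /P big_geq// !addr0.
  rewrite -(big_mkord xpredT y) big_nat_recr//= {2}/y ltnn addr0.
  rewrite big_ltn// {1}/y/= {1}/W expr0 mulr1 lerD2l// /P.
  rewrite le_eqVlt; apply/orP; left; apply/eqP.
  by apply: eq_big_nat => i; rewrite /y => /andP[_ ->].
have key j : (1 <= j < N.+1)%N -> W j <=
    K * (rho * cauchy_product W W j.-1 + cauchy_product (cauchy_product z z) y j + cauchy_product z z j).
  move=> /andP[j1 jN]; rewrite {1}/W.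
  have rj : 0 <= rho ^+ j by rewrite exprn_ge0// ltW.
  apply: (le_trans (ler_wpM2r rj (HX j j1))).
  rewrite -mulrA ler_wpM2l// !mulrDl lerD//; [rewrite lerD//|].
  - rewrite mulr_suml /cauchy_product mulr_sumr prednK//.
    rewrite -(big_mkord xpredT (fun n => rho * (W n * W (j.-1 - n)%N))).
    rewrite big_add1/= le_eqVlt; apply/orP; left; apply/eqP.
    apply: eq_big_nat => i /andP[_ ij].
    have -> : (j.-1 - i)%N = (j - i.+1)%N by clear -ij; lia.
    have -> : rho ^+ j = rho * rho ^+ (i + (j - i.+1)).
      by rewrite -exprS; congr (_ ^+ _); clear -ij; lia.
    by rewrite mulrCA WW.
  - rewrite mulr_suml.
    apply: (@le_trans _ _ (\sum_(2 <= n < j.+1) cauchy_product z z n * y (j - n)%N)).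
      rewrite big_nat_cond [leRHS]big_nat_cond; apply: ler_sum => n /andP[nj _].
      have -> : (\sum_(1 <= m < n) X m * X (n - m)%N * X (j - n)%N) * rho ^+ j =
          (\sum_(1 <= m < n) W m * W (n - m)%N) * W (j - n)%N.
        rewrite !mulr_suml; apply: eq_big_nat => m /andP[m1 mn].
        rewrite -WW /W.
        have -> : rho ^+ j = rho ^+ (m + (n - m)) * rho ^+ (j - n).
          by rewrite -exprD; congr (_ ^+ _); clear -m1 mn nj; lia.
        by ring.
      have jnN : (j - n < N)%N by clear -nj jN; lia.
      have nN : (n <= N)%N by clear -nj jN; lia.
      have -> : y (j - n)%N = W (j - n)%N by rewrite /y jnN.
      apply: (ler_wpM2r (W0 _)); apply: (@sum_inner_le_cauchy_product _ _ N) => //.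
      by move=> i; rewrite /z => ->.
    rewrite /cauchy_product -(big_mkord xpredT (fun n => cauchy_product z z n * y (j - n)%N)).
    rewrite [leRHS](@big_cat_nat _ _ _ 2)//= lerDr.
    by apply: sumr_ge0 => i _; rewrite mulr_ge0// cauchy_product_ge0.
  - rewrite mulr_suml (@eq_big_nat _ _ _ _ _ _ (fun n => W n * W (j - n)%N)).
      apply: (@sum_inner_le_cauchy_product _ _ N) => //.
      by move=> i; rewrite /z => ->.
    by move=> i /andP[_ ij]; rewrite -WW subnKC// ltnW.
have : \sum_(1 <= j < N.+1) W j <=
    K * (rho * (x0 + P) ^+ 2 + P ^+ 2 * (x0 + P) + P ^+ 2).
  apply: (@le_trans _ _ (\sum_(1 <= j < N.+1)
      K * (rho * cauchy_product W W j.-1 + cauchy_product (cauchy_product z z) y j + cauchy_product z z j))).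
    rewrite big_nat_cond [leRHS]big_nat_cond.
    by apply: ler_sum => j /andP[/key].
  have czz n : 0 <= cauchy_product z z n by exact: cauchy_product_ge0.
  have szz : \sum_(n < N.+1) cauchy_product z z n <= P ^+ 2.
    by apply: (le_trans (sum_cauchy_product_le _ z0 z0)); rewrite sz.
  rewrite -mulr_sumr ler_wpM2l// !big_split/=; apply: lerD; [apply: lerD|].
  - rewrite -mulr_sumr ler_wpM2l ?(ltW rho0)// big_add1/= big_mkord.
    apply: (le_trans (sum_cauchy_product_le _ W0 W0)); rewrite -expr2.
    rewrite ler_sqr ?nnegrE ?addr_ge0//; last exact: sumr_ge0.
    case: N @P {IH P0 z y z0 y0 sz sy key szz czz} => [|N] P.
      by rewrite big_ord0 addr_ge0// /P big_geq.
    by rewrite -(big_mkord xpredT W) big_ltn// {1}/W expr0 mulr1.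
  - apply: (@le_trans _ _ (\sum_(n < N.+1) cauchy_product (cauchy_product z z) y n)).
      rewrite -(big_mkord xpredT (fun n => cauchy_product (cauchy_product z z) y n)).
      by rewrite [leRHS]big_ltn//= lerDr cauchy_product_ge0.
    apply: (le_trans (sum_cauchy_product_le _ czz y0)).
    by apply: ler_pM => //; apply: sumr_ge0.
  - apply: (le_trans _ szz).
    rewrite -(big_mkord xpredT (fun n => cauchy_product z z n)).
    by rewrite [leRHS]big_ltn//= lerDr.
move=> /le_trans; apply.
have h1 : K * (rho * (x0 + P) ^+ 2) <= A / 2.
  apply: (@le_trans _ _ ((K + 1) * (rho * (x0 + 1) ^+ 2))); last by lra.
  have r0 := ltW rho0; apply: ler_pM => //; first by rewrite mulr_ge0 ?sqr_ge0.
    by lra.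
  by rewrite ler_wpM2l// ler_sqr ?nnegrE; lra.
have h2 : K * (P ^+ 2 * (x0 + P) + P ^+ 2) <= A / 2.
  have -> : K * (P ^+ 2 * (x0 + P) + P ^+ 2) = (K * (x0 + P + 1)) * P ^+ 2 by ring.
  apply: (@le_trans _ _ ((K + 1) * (x0 + 2) * A ^+ 2)).
    rewrite ler_pM ?sqr_ge0//; first by nra.
      by rewrite ler_pM//; lra.
    by rewrite ler_sqr ?nnegrE ?(ltW A0).
  have -> : (K + 1) * (x0 + 2) * A ^+ 2 = A * (A * ((K + 1) * (x0 + 2) * 2)) / 2.
    by field.
  by rewrite AE mulr1.
rewrite -addrA mulrDr; lra.
Qed.

End Majorant.

(** * Complex L^2 functions and integrals on the strip *)
Section ComplexModulus.
Variable R : realType.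
Implicit Types x y : R[i].

Lemma Re_addc x y : Re (x + y) = Re x + Re y. Proof. by case: x; case: y. Qed.
Lemma Im_addc x y : Im (x + y) = Im x + Im y. Proof. by case: x; case: y. Qed.
Lemma Re_oppc x : Re (- x) = - Re x. Proof. by case: x. Qed.
Lemma Im_oppc x : Im (- x) = - Im x. Proof. by case: x. Qed.
Lemma Re_mulc x y : Re (x * y) = Re x * Re y - Im x * Im y.
Proof. by case: x; case: y. Qed.
Lemma Im_mulc x y : Im (x * y) = Re x * Im y + Im x * Re y.
Proof. by case: x; case: y. Qed.

Lemma complex_ext x y : Re x = Re y -> Im x = Im y -> x = y.
Proof. by case: x => ? ?; case: y => ? ? /= -> ->. Qed.

Lemma normcE x : normc x = Num.sqrt (Re x ^+ 2 + Im x ^+ 2).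
Proof. by case: x. Qed.

Lemma normc_ge0 x : 0 <= normc x.
Proof. by rewrite normcE sqrtr_ge0. Qed.

Lemma sqr_normc x : normc x ^+ 2 = Re x ^+ 2 + Im x ^+ 2.
Proof. by rewrite normcE sqr_sqrtr// addr_ge0// sqr_ge0. Qed.

Lemma normRe_le x : `|Re x| <= normc x.
Proof.
by rewrite -sqrtr_sqr normcE ler_wsqrtr// lerDl sqr_ge0.
Qed.

Lemma normIm_le x : `|Im x| <= normc x.
Proof.
by rewrite -sqrtr_sqr normcE ler_wsqrtr// lerDr sqr_ge0.
Qed.

Lemma normc_le_ReIm x : normc x <= `|Re x| + `|Im x|.
Proof.
rewrite -ler_sqr ?nnegrE ?addr_ge0 ?normc_ge0// sqr_normc.
rewrite -(real_normK (num_real (Re x))) -(real_normK (num_real (Im x))).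
have := normr_ge0 (Re x); have := normr_ge0 (Im x); nra.
Qed.

Lemma normcR (t : R) : normc t%:C = `|t|.
Proof. by rewrite normcE/= expr0n/= addr0 sqrtr_sqr. Qed.

Lemma normc_expi (t : R) : normc (expi t) = 1.
Proof. by rewrite normcE /= cos2Dsin2 sqrtr1. Qed.

Lemma normc_ci : normc (ci : R[i]) = 1.
Proof. by rewrite normcE /= expr0n/= add0r expr1n sqrtr1. Qed.

End ComplexModulus.

Section L2Strip.
Variables (R : realType) (L : R).
Notation T := (measurableTypeR R * measurableTypeR R)%type.
Notation S := (strip L : set T).
Notation mu := (@leb2 R).
Implicit Types f g : R * R -> R[i].

Lemma measurable_strip : measurable S.
Proof.
have -> : S = (`](- (L / 2)), (L / 2)[ : set (measurableTypeR R)) `*` setT.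
  apply/seteqP; split => -[y z] /=; rewrite /strip/= in_itv/= ltr_norml.
    by move=> ?; split.
  by case.
by apply: measurableX => //; exact: measurable_itv.
Qed.
Local Hint Resolve measurable_strip : core.

Definition cmeasurable f :=
  measurable_fun S (fun r => Re (f r)) /\ measurable_fun S (fun r => Im (f r)).

Lemma cmeasurable_cst (c : R[i]) : cmeasurable (fun=> c).
Proof. by split; exact: measurable_cst. Qed.

Lemma cmeasurableR (h : R * R -> R) : measurable_fun S h ->
  cmeasurable (fun r => (h r)%:C).
Proof. by move=> mh; split => //=; exact: measurable_cst. Qed.

Lemma cmeasurableD f g : cmeasurable f -> cmeasurable g ->
  cmeasurable (fun r => f r + g r).
Proof.
move=> [f1 f2] [g1 g2]; split.
  by under eq_fun do rewrite Re_addc; exact: measurable_funD.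
by under eq_fun do rewrite Im_addc; exact: measurable_funD.
Qed.

Lemma cmeasurableM f g : cmeasurable f -> cmeasurable g ->
  cmeasurable (fun r => f r * g r).
Proof.
move=> [f1 f2] [g1 g2]; split.
  under eq_fun do rewrite Re_mulc.
  by apply: measurable_funB; exact: measurable_funM.
under eq_fun do rewrite Im_mulc.
by apply: measurable_funD; exact: measurable_funM.
Qed.

Lemma cmeasurable_expi (b : R) : cmeasurable (fun r => expi (b * r.1)).
Proof.
have m1 : measurable_fun S (fun r : T => b * r.1).
  by apply: measurable_funM => //; apply: measurable_funTS; exact: measurable_fst.
split => /=.
  apply: (measurableT_comp (f := @cos R)) => //.
  by apply: continuous_measurable_fun; exact: continuous_cos.
apply: (measurableT_comp (f := @sin R)) => //.
by apply: continuous_measurable_fun; exact: continuous_sin.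
Qed.

Lemma measurable_normc f : cmeasurable f -> measurable_fun S (fun r => normc (f r)).
Proof.
move=> [f1 f2]; under eq_fun do rewrite normcE.
apply: (measurableT_comp (f := @Num.sqrt R)).
  by apply: continuous_measurable_fun; exact: sqrt_continuous.
by apply: measurable_funD; exact: measurable_funX.
Qed.

Lemma L2_sqint f : L2 S f -> sqint mu S (fun r => normc (f r)).
Proof. by case=> f1 f2 fi; split => //; exact: measurable_normc. Qed.

Lemma L2_cmeasurable f : L2 S f -> cmeasurable f.
Proof. by case. Qed.

Lemma L2norm_ge0 f : 0 <= L2norm L f.
Proof. exact: sqnorm_ge0. Qed.

Lemma L2_dominated f (h : T -> R) : cmeasurable f -> sqint mu S h ->
  {ae mu, forall r, S r -> normc (f r) <= `|h r|} ->
  L2 S f /\ L2norm L f <= sqnorm mu S h.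
Proof.
move=> mf hi fh.
have fh' : {ae mu, forall r, S r -> `|normc (f r)| <= `|h r|}.
  by apply: filterS fh => r /[apply] rh; rewrite [leLHS]ger0_norm ?normc_ge0.
have [[_ i1] le] := sqint_le measurable_strip (measurable_normc mf) hi fh'.
by split => //; case: mf.
Qed.

Lemma L2D f g : L2 S f -> L2 S g -> L2 S (fun r => f r + g r) /\
  L2norm L (fun r => f r + g r) <= L2norm L f + L2norm L g.
Proof.
move=> Hf Hg.
have [|||h1 h2] := @L2_dominated (fun r => f r + g r)
   (fun r => normc (f r) + normc (g r)).
- by apply: cmeasurableD; exact: L2_cmeasurable.
- by apply: sqintD => //; exact: L2_sqint.
- apply: aeW => r _; rewrite [leRHS]ger0_norm ?addr_ge0 ?normc_ge0//.
  exact: le_normcD.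
split => //; apply: (le_trans h2); apply: sqnormD => //; exact: L2_sqint.
Qed.

Lemma L2_mul_bounded f g (M : R) : cmeasurable g -> L2 S f ->
  {ae mu, forall r, S r -> normc (g r) <= M} -> 0 <= M ->
  L2 S (fun r => g r * f r) /\
  L2norm L (fun r => g r * f r) <= M * L2norm L f.
Proof.
move=> mg Hf gM M0.
have [h1 E] := sqintZ measurable_strip M (L2_sqint Hf).
have [|||k1 k2] := @L2_dominated (fun r => g r * f r)
   (fun r => M * normc (f r)).
- by apply: cmeasurableM => //; exact: L2_cmeasurable.
- by [].
- apply: filterS gM => r /[apply] h; rewrite ComplexField.Normc.normcM.
  by rewrite ger0_norm ?mulr_ge0 ?normc_ge0// ler_wpM2r ?normc_ge0.
by split => //; move: k2; rewrite E ger0_norm.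
Qed.

Lemma L2Z (c : R[i]) f : L2 S f -> L2 S (fun r => c * f r) /\
  L2norm L (fun r => c * f r) <= normc c * L2norm L f.
Proof.
move=> Hf; have ae1 : {ae mu, forall r, S r -> normc c <= normc c} by apply: aeW.
exact: L2_mul_bounded (cmeasurable_cst c) Hf ae1 (normc_ge0 c).
Qed.

Lemma L2_expi (b : R) f : L2 S f -> L2 S (fun r => f r * expi (b * r.1)).
Proof.
move=> Hf; under eq_fun do rewrite mulrC.
have ae1 : {ae mu, forall r, S r -> normc (expi (b * r.1)) <= 1}.
  by apply: aeW => r _; rewrite normc_expi.
by have [] := L2_mul_bounded (cmeasurable_expi b) Hf ae1 ler01.
Qed.

Lemma L2_0 : L2 S (fun=> 0) /\ L2norm L (fun=> 0) = 0.
Proof.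
have [h1 h2] := sqint0 mu S.
have [|||k1 k2] := @L2_dominated (fun=> 0) (fun=> 0).
- exact: cmeasurable_cst.
- exact: h1.
- by apply: aeW => r _; rewrite normcR.
by split => //; apply/eqP; rewrite eq_le L2norm_ge0 andbT -h2.
Qed.

Lemma L2_Re f : L2 S f -> sqint mu S (fun r => Re (f r)) /\
  sqnorm mu S (fun r => Re (f r)) <= L2norm L f.
Proof.
move=> Hf; apply: sqint_le => //; [by case: Hf|exact: L2_sqint|].
by apply: aeW => r _; rewrite [leRHS]ger0_norm ?normc_ge0 ?normRe_le.
Qed.

Lemma L2_Im f : L2 S f -> sqint mu S (fun r => Im (f r)) /\
  sqnorm mu S (fun r => Im (f r)) <= L2norm L f.
Proof.
move=> Hf; apply: sqint_le => //; [by case: Hf|exact: L2_sqint|].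
by apply: aeW => r _; rewrite [leRHS]ger0_norm ?normc_ge0 ?normIm_le.
Qed.

Lemma L2_sum (f : nat -> R * R -> R[i]) (c : nat -> R) m n :
  (forall i, (m <= i < n)%N -> L2 S (f i) /\ L2norm L (f i) <= c i) ->
  L2 S (fun r => \sum_(m <= i < n) f i r) /\
  L2norm L (fun r => \sum_(m <= i < n) f i r) <= \sum_(m <= i < n) c i.
Proof.
elim: n => [|n IH] H.
  have [h1 h2] := L2_0; under eq_fun do rewrite big_geq//.
  rewrite [leRHS]big_geq//; split => //.
  by rewrite h2.
have [mn|nm] := leqP m n; last first.
  have [h1 h2] := L2_0; under eq_fun do rewrite big_geq//.
  rewrite [leRHS]big_geq//; split => //.
  by rewrite h2.
have [i1 i2] : L2 S (fun r => \sum_(m <= i < n) f i r) /\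
  L2norm L (fun r => \sum_(m <= i < n) f i r) <= \sum_(m <= i < n) c i.
  by apply: IH => i /andP[? ?]; apply: H; lia.
have [j1 j2] := H n ltac:(lia).
have -> : (fun r => \sum_(m <= i < n.+1) f i r) =
          (fun r => \sum_(m <= i < n) f i r + f n r).
  by apply/funext => r; rewrite big_nat_recr.
have [k1 k2] := L2D i1 j1; split => //.
by rewrite big_nat_recr//=; apply: (le_trans k2); rewrite lerD.
Qed.

Lemma cintegrableD f g : cintegrable S f -> cintegrable S g ->
  cintegrable S (fun r => f r + g r) /\
  cint S (fun r => f r + g r) = cint S f + cint S g.
Proof.
move=> [f1 f2] [g1 g2]; split.
  split.
    have -> : (fun r => (Re (f r + g r))%:E) =
      ((fun r => (Re (f r))%:E) \+ (fun r => (Re (g r))%:E))%E.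
      by apply/funext => r /=; rewrite Re_addc.
    exact: integrableD.
  have -> : (fun r => (Im (f r + g r))%:E) =
    ((fun r => (Im (f r))%:E) \+ (fun r => (Im (g r))%:E))%E.
    by apply/funext => r /=; rewrite Im_addc.
  exact: integrableD.
rewrite /cint; apply: complex_ext; rewrite ?Re_addc ?Im_addc /= -RintegralD//.
  by apply: eq_Rintegral => r _; rewrite Re_addc.
by apply: eq_Rintegral => r _; rewrite Im_addc.
Qed.

Lemma cintegrableZ (c : R[i]) f : cintegrable S f ->
  cintegrable S (fun r => c * f r) /\
  cint S (fun r => c * f r) = c * cint S f.
Proof.
move=> [f1 f2].
have iZ (a : R) (h : T -> R) : mu.-integrable S (EFin \o h) ->
    mu.-integrable S (EFin \o (fun r => a * h r)).
  by move=> ih; have := integrableZl measurable_strip a ih; exact.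
have iRe := iZ _ _ f1; have iIm := iZ _ _ f2.
split.
  split.
    have -> : (fun r => (Re (c * f r))%:E) =
      ((EFin \o (fun r => Re c * Re (f r))%R) \-
       (EFin \o (fun r => Im c * Im (f r))%R))%E.
      by apply/funext => r /=; rewrite Re_mulc.
    exact: integrableB.
  have -> : (fun r => (Im (c * f r))%:E) =
    ((EFin \o (fun r => Re c * Im (f r))%R) \+
     (EFin \o (fun r => Im c * Re (f r))%R))%E.
    by apply/funext => r /=; rewrite Im_mulc.
  exact: integrableD.
rewrite /cint; apply: complex_ext; rewrite ?Re_mulc ?Im_mulc /= -!RintegralZl//.
  rewrite -RintegralB//.
  by apply: eq_Rintegral => r _; rewrite Re_mulc.
rewrite -RintegralD//.
by apply: eq_Rintegral => r _; rewrite Im_mulc.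
Qed.

Lemma cint_ae f g : cmeasurable f -> cmeasurable g ->
  {ae mu, forall r, S r -> f r = g r} -> cint S f = cint S g.
Proof.
move=> [f1 f2] [g1 g2] fg; rewrite /cint /Rintegral.
congr (fine _ +i* fine _); apply: ae_eq_integral => //; try exact/measurable_EFinP.
  by apply: filterS fg => r /[apply] ->.
by apply: filterS fg => r /[apply] ->.
Qed.

Definition pairing f (h : R * R -> R) : R[i] := cint S (fun r => f r * (h r)%:C).

Lemma pairing_integrable f h : L2 S f -> sqint mu S h ->
  cintegrable S (fun r => f r * (h r)%:C).
Proof.
move=> Hf Hh; split.
  have -> : (fun r => (Re (f r * (h r)%:C))%:E) =
            EFin \o (fun r => Re (f r) * h r).
    by apply/funext => r; rewrite /= Re_mulc /= mulr0 subr0.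
  by apply: sqint_integrableM => //; have [] := L2_Re Hf.
have -> : (fun r => (Im (f r * (h r)%:C))%:E) =
          EFin \o (fun r => Im (f r) * h r).
  by apply/funext => r; rewrite /= Im_mulc /= mulr0 add0r.
by apply: sqint_integrableM => //; have [] := L2_Im Hf.
Qed.

Lemma pairing_bound f h : L2 S f -> sqint mu S h ->
  normc (pairing f h) <= 2 * L2norm L f * sqnorm mu S h.
Proof.
move=> Hf Hh; apply: (le_trans (normc_le_ReIm _)); rewrite /pairing /cint /=.
have [r1 r2] := L2_Re Hf; have [i1 i2] := L2_Im Hf.
rewrite -mulrA mulrDl mul1r; apply: lerD.
  under eq_Rintegral do rewrite Re_mulc /= mulr0 subr0.
  apply: (le_trans (sqint_cauchy_schwarz measurable_strip r1 Hh)).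
  exact: (ler_wpM2r (sqnorm_ge0 _ _ _)).
under eq_Rintegral do rewrite Im_mulc /= mulr0 add0r.
apply: (le_trans (sqint_cauchy_schwarz measurable_strip i1 Hh)).
exact: (ler_wpM2r (sqnorm_ge0 _ _ _)).
Qed.

Lemma pairingDl f g h : L2 S f -> L2 S g -> sqint mu S h ->
  pairing (fun r => f r + g r) h = pairing f h + pairing g h.
Proof.
move=> Hf Hg Hh; rewrite /pairing.
have [_ <-] := cintegrableD (pairing_integrable Hf Hh) (pairing_integrable Hg Hh).
by congr cint; apply/funext => r; rewrite mulrDl.
Qed.

Lemma pairingZl c f h : L2 S f -> sqint mu S h ->
  pairing (fun r => c * f r) h = c * pairing f h.
Proof.
move=> Hf Hh; rewrite /pairing.
have [_ <-] := cintegrableZ c (pairing_integrable Hf Hh).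
by congr cint; apply/funext => r; rewrite mulrA.
Qed.

Lemma pairingDr f h k : L2 S f -> sqint mu S h -> sqint mu S k ->
  pairing f (fun r => h r + k r) = pairing f h + pairing f k.
Proof.
move=> Hf Hh Hk; rewrite /pairing.
have [_ <-] := cintegrableD (pairing_integrable Hf Hh) (pairing_integrable Hf Hk).
by congr cint; apply/funext => r; rewrite rmorphD mulrDr.
Qed.

Lemma pairingZr (a : R) f h : L2 S f -> sqint mu S h ->
  pairing f (fun r => a * h r) = a%:C * pairing f h.
Proof.
move=> Hf Hh; rewrite /pairing.
have [_ <-] := cintegrableZ a%:C (pairing_integrable Hf Hh).
by congr cint; apply/funext => r; rewrite rmorphM mulrCA.
Qed.

End L2Strip.

(** * Partial derivatives and regularity of test functions *)
Section PartialDerivatives.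
Variable R : realType.
Implicit Types (psi : R * R -> R) (r : R * R).

Definition ey : R * R := (1, 0).
Definition ez : R * R := (0, 1).

Lemma is_derive_ey psi (y z d : R) :
  is_derive y (1 : R) (fun t : R => psi (t, z)) d <-> is_derive (y, z) ey psi d.
Proof.
have E : (fun h : R => h^-1 *: ((psi \o shift (y, z)) (h *: ey) - psi (y, z))) =
    (fun h : R => h^-1 *: (((fun t => psi (t, z)) \o shift y) (h *: (1 : R)) - psi (y, z))).
  apply/funext => h /=; congr (_ *: (psi _ - _)).
  rewrite /shift/= /ey; congr pair => /=.
  by rewrite [X in X + _]mulr0 add0r.
by split => -[d1 d2]; split; move: d1 d2; rewrite /derivable /derive E.
Qed.

Lemma is_derive_ez psi (y z d : R) :
  is_derive z (1 : R) (fun t : R => psi (y, t)) d <-> is_derive (y, z) ez psi d.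
Proof.
have E : (fun h : R => h^-1 *: ((psi \o shift (y, z)) (h *: ez) - psi (y, z))) =
    (fun h : R => h^-1 *: (((fun t => psi (y, t)) \o shift z) (h *: (1 : R)) - psi (y, z))).
  apply/funext => h /=; congr (_ *: (psi _ - _)).
  rewrite /shift/= /ez; congr pair => /=.
  by rewrite [X in X + _]mulr0 add0r.
by split => -[d1 d2]; split; move: d1 d2; rewrite /derivable /derive E.
Qed.

Lemma lipschitz_derive (f df : R -> R) (M : R) :
  (forall x, is_derive x (1 : R) f (df x)) -> (forall x, `|df x| <= M) ->
  forall x y, `|f y - f x| <= M * `|y - x|.
Proof.
move=> fd fM.
have W x y : x <= y -> `|f y - f x| <= M * `|y - x|.
  move=> xy.
  have cf : {within `[x, y], continuous f}.
    apply: continuous_subspaceT => t; apply: differentiable_continuous.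
    by apply/derivable1_diffP; have [] := fd t.
  have [c _ ->] := MVT_segment xy (fun t _ => fd t) cf.
  by rewrite normrM ler_wpM2r.
by move=> x y; have [/W//|/ltW/W] := leP x y; rewrite distrC [X in _ * X]distrC.
Qed.

Lemma derive_off_support psi (K : set (R * R)) (v : R * R) r :
  closed K -> (forall r, ~ K r -> psi r = 0) -> ~ K r -> 'D_v psi r = 0.
Proof.
move=> cK psi0 Kr.
have oK : open (~` K) by exact: closed_openC.
have nK : \forall s \near r, psi s = 0.
  have : nbhs r (~` K) by exact: open_nbhs_nbhs.
  by apply: filterS => s; exact: psi0.
rewrite /derive; apply: cvg_lim; first exact: norm_hausdorff.
apply: cvg_near_cst.
have c : (h *: v + r) @[h --> (0 : R)^'] --> r.
  rewrite -[X in _ --> X]add0r -(scale0r v).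
  apply: cvgD; last exact: cvg_cst.
  apply: cvgZl => //; exact: cvg_within.
have pz : \forall h \near (0 : R)^', psi (h *: v + r) = 0 by exact: (c _ nK).
apply: filterS pz => h /= ->.
by rewrite (psi0 _ Kr) subrr scaler0.
Qed.

Lemma continuous_bounded_of_support (f : R * R -> R) (K : set (R * R)) :
  continuous f -> compact K -> (forall r, ~ K r -> f r = 0) ->
  exists2 M, 0 <= M & forall r, `|f r| <= M.
Proof.
move=> cf cK f0.
have cfK : compact (f @` K).
  by apply: continuous_compact => //; exact: continuous_subspaceT.
have [M [_ HM]] := compact_bounded cfK.
exists (`|M| + 1); first by rewrite addr_ge0.
move=> r; have [Kr|/f0 ->] := pselect (K r); last by rewrite normr0 addr_ge0.
have lt : M < `|M| + 1 by rewrite (le_lt_trans (ler_norm _))// ltrDl.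
by apply: (HM _ lt); exists r.
Qed.

(** The partial derivatives are bounded, being continuous with compact support,
    so psi is Lipschitz in each variable uniformly in the other. *)
Lemma test_fun_continuous (U : set (R * R)) psi : test_fun U psi ->
  continuous psi.
Proof.
move=> [dpsi cy cz [K [cK KU psi0]]].
have clK : closed K by apply: compact_closed => //; exact: norm_hausdorff.
have [My My0 HMy] := continuous_bounded_of_support cy cK
   (fun r => @derive_off_support psi K _ r clK psi0).
have [Mz Mz0 HMz] := continuous_bounded_of_support cz cK
   (fun r => @derive_off_support psi K _ r clK psi0).
have Ly y y' z : `|psi (y', z) - psi (y, z)| <= My * `|y' - y|.
  apply: (@lipschitz_derive (fun t => psi (t, z)) (fun t => 'D_ey psi (t, z))).
    by move=> t; apply/is_derive_ey; exact: (derivableP (dpsi (t, z)).1).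
  by move=> t; exact: HMy.
have Lz y z z' : `|psi (y, z') - psi (y, z)| <= Mz * `|z' - z|.
  apply: (@lipschitz_derive (fun t => psi (y, t)) (fun t => 'D_ez psi (y, t))).
    by move=> t; apply/is_derive_ez; exact: (derivableP (dpsi (y, t)).2).
  by move=> t; exact: HMz.
move=> -[y z]; apply/cvgrPdist_le => e e0.
have M1 : 0 < My + Mz + 1 by lra.
have nb : nbhs ((y, z) : R * R) (ball ((y, z) : R * R) (e / (My + Mz + 1))).
  by apply: nbhsx_ballx; rewrite divr_gt0.
near=> s.
have sb : ball ((y, z) : R * R) (e / (My + Mz + 1)) s by near: s; exact: nb.
suff H y' z' : ball ((y, z) : R * R) (e / (My + Mz + 1)) (y', z') ->
    `|psi (y, z) - psi (y', z')| <= e.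
  by move: sb; rewrite (surjective_pairing s); exact: H.
move=> [/= h1 h2]; rewrite /ball/= in h1 h2.
have -> : psi (y, z) - psi (y', z') =
   (psi (y, z) - psi (y', z)) + (psi (y', z) - psi (y', z')) by ring.
apply: (le_trans (ler_normD _ _)).
have := Ly y' y z; have := Lz y' z' z.
have l1 : My * `|y - y'| <= My * (e / (My + Mz + 1)) by rewrite ler_wpM2l// ltW.
have l2 : Mz * `|z - z'| <= Mz * (e / (My + Mz + 1)) by rewrite ler_wpM2l// ltW.
have e1 : (My + Mz + 1) * (e / (My + Mz + 1)) = e.
  by rewrite mulrC divfK// gt_eqF.
have e2 : 0 < e / (My + Mz + 1) by rewrite divr_gt0.
move: l1 l2 e1 e2; set q := e / _; nra.
Unshelve. all: by end_near. Qed.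

End PartialDerivatives.

(** * Measurability in the plane *)
Section PlaneMeasurability.
Variable R : realType.
Notation T := (measurableTypeR R * measurableTypeR R)%type.
Notation mu := (@leb2 R).

Definition box (a b c d : R) : set T := `]a, b[%classic `*` `]c, d[%classic.

Lemma measurable_box a b c d : measurable (box a b c d).
Proof. by apply: measurableX; exact: measurable_itv. Qed.

Lemma box_finite a b c d : (mu (box a b c d) < +oo)%E.
Proof.
rewrite /leb2 /box product_measure1E; try exact: measurable_itv.
rewrite /= !lebesgue_measure_itv /=.
by case: ifP => _; case: ifP => _; rewrite ?mul0e ?mule0 ?ltry// -EFinM ltry.
Qed.

(** Every open set is a countable union of boxes with rational corners. *)
Lemma open_measurable2 (U : set (R * R)) : open U -> measurable (U : set T).
Proof.
move=> oU.
pose Q (q : rat * rat * (rat * rat)) : set T :=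
  box (ratr q.1.1) (ratr q.1.2) (ratr q.2.1) (ratr q.2.2).
have -> : (U : set T) = \bigcup_(q in [set q | Q q `<=` U]) Q q.
  apply/seteqP; split; last by move=> r [q /= QU Qr]; exact: QU.
  move=> [y z] Uyz.
  have : nbhs ((y, z) : R * R) U by exact: open_nbhs_nbhs.
  rewrite -nbhs_ballE => -[e /= e0 eU].
  have [a] := @rat_in_itvoo R (y - e) y ltac:(lra).
  have [b] := @rat_in_itvoo R y (y + e) ltac:(lra).
  have [c] := @rat_in_itvoo R (z - e) z ltac:(lra).
  have [d] := @rat_in_itvoo R z (z + e) ltac:(lra).
  rewrite !in_itv/= => /andP[d1 d2] /andP[c1 c2] /andP[b1 b2] /andP[a1 a2].
  exists (a, b, (c, d)) => /=; last first.
    by split => /=; rewrite in_itv/=; apply/andP.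
  move=> [y' z'] [/=]; rewrite !in_itv/= => /andP[y1 y2] /andP[z1 z2].
  apply: eU; split; rewrite /ball/= ltr_norml; apply/andP; split; lra.
rewrite bigcup_mkcond; apply: countable_bigcupT_measurable => [|q].
  exact: countableP.
by case: ifP => _ //; exact: measurable_box.
Qed.

Lemma continuous_measurable_fun2 (f : R * R -> R) : continuous f ->
  measurable_fun (setT : set T) (f : T -> R).
Proof.
move=> cf; apply: (measurability _ (RGenOInfty.measurableE R)).
move=> _ [_ [x ->] <-]; rewrite setTI.
apply: open_measurable2; apply: open_comp; last exact: rray_open.
by move=> r _; exact: cf.
Qed.

Lemma sqint_bounded_box (D : set T) (f : R * R -> R) (M a b c d : R) :
  measurable D -> measurable_fun D (f : T -> R) -> (forall r, `|f r| <= M) ->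
  (forall r, D r -> ~ box a b c d r -> f r = 0) -> sqint mu D f.
Proof.
move=> mD mf fM f0.
have M0 : 0 <= M by apply: le_trans (fM (0, 0)).
pose B := box a b c d.
have mi : measurable_fun D (fun r : T => M * \1_B r).
  by apply: measurable_funM => //; apply/measurable_indic; exact: measurable_box.
have H : sqint mu D (fun r : T => M * \1_B r).
  have [] // := @sqintZ _ _ _ mu D mD M (\1_B); split.
    by apply/measurable_indic; exact: measurable_box.
  have E (r : T) : ((\1_B r : R) ^+ 2)%:E = (\1_B r)%:E.
    by rewrite indicE; case: (r \in B); rewrite ?expr0n ?expr1n.
  under eq_integral do rewrite E.
  rewrite integral_indic//; last exact: measurable_box.
  apply: le_lt_trans (box_finite a b c d).
  have mB := measurable_box a b c d.
  by apply: le_measure; rewrite ?inE//; exact: measurableI.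
have [] // := @sqint_le _ _ _ mu D mD f _ mf H.
apply: aeW => r Dr; rewrite indicE; have [rB|rB] := boolP (r \in B).
  by rewrite mulr1 [leRHS]ger0_norm.
by rewrite mulr0 (f0 _ Dr) ?normr0// => Br; move: rB; rewrite mem_set.
Qed.

Lemma sqint_continuous (D : set T) (f : R * R -> R) (K : set (R * R)) :
  measurable D -> continuous f -> compact K -> (forall r, ~ K r -> f r = 0) ->
  sqint mu D f.
Proof.
move=> mD cf cK f0.
have [M M0 fM] := continuous_bounded_of_support cf cK f0.
have [N [_ HN]] := compact_bounded cK.
have NN : N < `|N| + 1 by rewrite (le_lt_trans (ler_norm _))// ltrDl.
have KN := HN _ NN; set N' := `|N| + 1 in KN.
apply: (@sqint_bounded_box _ _ M (- (N' + 1)) (N' + 1) (- (N' + 1)) (N' + 1)) => //.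
  by apply: measurable_funTS; exact: continuous_measurable_fun2.
move=> [y z] _ nB; apply: f0 => Kr; apply: nB.
have := KN _ Kr; rewrite /Num.norm/= ge_max => /andP[h1 h2].
split; rewrite /= in_itv/=; rewrite -ltr_norml; lra.
Qed.

End PlaneMeasurability.

Section Boxes.
Variable R : realType.
Notation T := (measurableTypeR R * measurableTypeR R)%type.

Definition boxes : set (set T) := [set B | exists a b c d, B = box a b c d].

Lemma setI_closed_boxes : setI_closed boxes.
Proof.
move=> _ _ [a [b [c [d ->]]]] [a' [b' [c' [d' ->]]]].
exists (Num.max a a'), (Num.min b b'), (Num.max c c'), (Num.min d d').
rewrite /box -setXI; congr (_ `*` _).
  apply/seteqP; split => x /=; rewrite !in_itv/= gt_max lt_min.
    by move=> [/andP[-> ->] /andP[-> ->]].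
  by move=> /andP[/andP[-> ->] /andP[-> ->]].
apply/seteqP; split => x /=; rewrite !in_itv/= gt_max lt_min.
  by move=> [/andP[-> ->] /andP[-> ->]].
by move=> /andP[/andP[-> ->] /andP[-> ->]].
Qed.

Lemma itv_exhaust : \bigcup_n `](- n%:R : R), n%:R[%classic = setT.
Proof.
apply/seteqP; split => // x _; exists (Num.bound x) => //=.
by rewrite in_itv/= ltrNl unstable.ltrNbound unstable.ltr_bound.
Qed.

(** Both projections are measurable for the sigma-algebra of the boxes, since an
    open vertical or horizontal slab is a countable union of boxes. *)
Lemma measurable_boxes : @measurable _ T = <<s boxes >>.
Proof.
apply/seteqP; split; last first.
  apply: smallest_sub; first exact: sigma_algebra_measurable.
  by move=> _ [a [b [c [d ->]]]]; exact: measurable_box.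
rewrite measurable_prod_measurableType.
apply: smallest_sub; first exact: smallest_sigma_algebra.
have m1 : measurable_fun setT
    (fst : g_sigma_algebraType boxes -> measurableTypeR R).
  apply: (measurability _ (RGenOpens.measurableE R)).
  move=> _ [_ [a [b ->]] <-]; rewrite setTI.
  rewrite (_ : fst @^-1` _ = \bigcup_n box a b (- n%:R) n%:R).
    by apply: bigcupT_measurable => n; apply: sub_sigma_algebra; do 4 eexists.
  rewrite /box -setX_bigcupr itv_exhaust.
  by apply/seteqP; split => -[y z] //= [].
have m2 : measurable_fun setT
    (snd : g_sigma_algebraType boxes -> measurableTypeR R).
  apply: (measurability _ (RGenOpens.measurableE R)).
  move=> _ [_ [a [b ->]] <-]; rewrite setTI.
  rewrite (_ : snd @^-1` _ = \bigcup_n box (- n%:R) n%:R a b).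
    by apply: bigcupT_measurable => n; apply: sub_sigma_algebra; do 4 eexists.
  rewrite /box -setX_bigcupl itv_exhaust.
  by apply/seteqP; split => -[y z] //= [].
move=> _ [A mA [B mB <-]].
have -> : A `*` B = (fst @^-1` A `&` snd @^-1` B) :> set T by [].
have := m1 measurableT A mA; have := m2 measurableT B mB; rewrite !setTI => k2 k1.
exact: (@measurableI _ (g_sigma_algebraType boxes) _ _ k1 k2).
Qed.

End Boxes.

(** * Bump functions *)
Section Bumps.
Variable R : realType.

Lemma is_derive_quadratic_error (f : R -> R) (x d : R) :
  (forall h, `|f (x + h) - f x - d * h| <= h ^+ 2) -> is_derive x (1 : R) f d.
Proof.
move=> H.
have c : (fun h : R => h^-1 *: ((f \o shift x) (h *: (1 : R)) - f x)) @ (0 : R)^' --> d.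
  apply/cvgrPdist_le => e e0.
  near=> h.
  have h0 : h != 0 by near: h; exact: nbhs_dnbhs_neq.
  have he : `|h| <= e.
    near: h; apply: dnbhs0_le; exact: e0.
  rewrite /= /shift/= [h *: 1]mulr1 (addrC h x).
  have -> : d - h^-1 *: (f (x + h) - f x) = - (h^-1 * (f (x + h) - f x - d * h)).
    by rewrite /GRing.scale/=; field.
  rewrite normrN normrM normfV; apply: le_trans he.
  rewrite ler_pdivrMl ?normr_gt0//; apply: (le_trans (H h)).
  by rewrite -[leLHS]real_normK ?num_real.
split; first by apply/cvg_ex; exists d.
exact: cvg_lim c.
Unshelve. all: by end_near. Qed.

Definition sqpos (t : R) : R := Num.max 0 t ^+ 2.

Lemma is_derive_sqpos (t : R) : is_derive t (1 : R) sqpos (2 * Num.max 0 t).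
Proof.
apply: is_derive_quadratic_error => h; rewrite /sqpos ler_norml.
by case: (leP 0 t) => ?; case: (leP 0 (t + h)) => ?; apply/andP; split; nra.
Qed.

Lemma continuous_max0 : continuous (fun t : R => Num.max 0 t).
Proof.
move=> t; apply: continuous_max; [exact: cvg_cst|exact: cvg_id].
Qed.

(** For a < b, a C^1 function that increases to the indicator of ]a, b[ as n
    grows.  With q = (x - a)(b - x) and w the square of the positive part of
    q - 1/(n+1), it is (n+1) w / (1 + (n+1) w); subtracting 1/(n+1) from q makes
    the support a compact subset of the open interval. *)
Definition bump (n : nat) (a b x : R) : R :=
  1 - (1 + n.+1%:R * sqpos ((x - a) * (b - x) - n.+1%:R^-1))^-1.

Lemma bump_den_ge1 n (t : R) : 1 <= 1 + n.+1%:R * sqpos t.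
Proof. by rewrite lerDl mulr_ge0// ?ler0n// sqr_ge0. Qed.

Lemma bump_bounds n a b x : 0 <= bump n a b x <= 1.
Proof.
rewrite /bump; have := bump_den_ge1 n ((x - a) * (b - x) - n.+1%:R^-1).
set q := 1 + _ => q1.
by rewrite subr_ge0 invf_le1 ?q1 ?lerBlDr ?lerDl ?invr_ge0; lra.
Qed.

Lemma bump_eq0 n a b x : (x - a) * (b - x) <= n.+1%:R^-1 -> bump n a b x = 0.
Proof.
move=> h; rewrite /bump /sqpos max_l; last by rewrite subr_le0.
by rewrite expr0n mulr0 addr0 invr1 subrr.
Qed.

Lemma bump_out n a b x : a < b -> ~ (`]a, b[%classic x) -> bump n a b x = 0.
Proof.
move=> ab xab; apply: bump_eq0; apply: (@le_trans _ _ 0); last by rewrite invr_ge0.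
move: xab; rewrite /= in_itv/= => /negP; rewrite negb_and -!leNgt.
case/orP => h; first by rewrite mulr_le0_ge0//; lra.
by rewrite mulr_ge0_le0//; lra.
Qed.

Lemma is_derive_bump n a b : exists2 p : R -> R,
  continuous p & forall x, is_derive x (1 : R) (bump n a b) (p x).
Proof.
pose q x := (x - a) * (b - x) - n.+1%:R^-1.
have dq x : is_derive x (1 : R) q (a + b - 2 * x).
  apply: is_derive_eq.
  rewrite /GRing.scale /=; ring.
pose w x := 1 + n.+1%:R * sqpos (q x).
have dw x : is_derive x (1 : R) w (n.+1%:R * (2 * Num.max 0 (q x) * (a + b - 2 * x))).
  have ds : is_derive x (1 : R) (sqpos \o q) (2 * Num.max 0 (q x) * (a + b - 2 * x)).
    have := is_derive_sqpos (q x); have := dq x => ? ?.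
    exact: is_derive1_comp.
  apply: is_derive_eq.
  rewrite /GRing.scale /=; ring.
have w0 x : w x != 0 by rewrite gt_eqF// (lt_le_trans ltr01)// bump_den_ge1.
exists (fun x => (w x)^-2 * (n.+1%:R * (2 * Num.max 0 (q x) * (a + b - 2 * x)))).
  have cq : continuous q.
    by move=> x; apply: differentiable_continuous; apply/derivable1_diffP; have [] := dq x.
  have cw : continuous w.
    by move=> x; apply: differentiable_continuous; apply/derivable1_diffP; have [] := dw x.
  move=> x; apply: cvgM.
    apply: cvgV; first by rewrite expf_neq0.
    by apply: cvgM; exact: cw.
  apply: cvgM; first exact: cvg_cst.
  apply: cvgM.
    apply: cvgM; first exact: cvg_cst.
    apply: (@continuous_comp _ _ _ q (fun t => Num.max 0 t)); first exact: cq.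
    exact: continuous_max0.
  by apply: cvgB; [exact: cvg_cst|apply: cvgM; [exact: cvg_cst|exact: cvg_id]].
move=> x; have dwx := dw x.
have dV := is_deriveV (w0 x) dwx.
have -> : bump n a b = cst 1 - (fun y => (w y)^-1) by apply/funext.
apply: is_derive_eq.
by rewrite /GRing.scale /=; field.
Qed.

Lemma cvg_bump a b x : a < b -> bump n a b x @[n --> \oo] --> (\1_(`]a, b[%classic) x : R).
Proof.
move=> ab; have [xab|xab] := boolP (x \in `]a, b[%classic).
  rewrite indicE xab; move/set_mem: xab; rewrite /= in_itv/= => /andP[ax xb].
  pose q := (x - a) * (b - x).
  have q0 : 0 < q by rewrite mulr_gt0// subr_gt0.
  (* once 1/(n+1) < q/2, w >= (q/2)^2 and 1 - bump <= 1 / ((n+1) (q/2)^2) *)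
  have harm0 : (4 / q ^+ 2) * harmonic n @[n --> \oo] --> (0 : R).
    by rewrite -[X in _ --> X](mulr0 (4 / q ^+ 2)); apply: cvgM; [exact: cvg_cst|exact: cvg_harmonic].
  apply/cvgrPdist_le => e e0.
  have := @cvg_harmonic R; move/cvgrPdist_lt/(_ (q / 2) ltac:(lra)) => h1.
  move/cvgrPdist_le/(_ e e0) : harm0 => h2.
  near=> n.
  have n1 : n.+1%:R^-1 < q / 2.
    have : `|0 - harmonic n| < q / 2 by near: n; exact: h1.
    by rewrite sub0r normrN ger0_norm ?invr_ge0.
  have n2 : 4 / q ^+ 2 * n.+1%:R^-1 <= e.
    have : `|0 - 4 / q ^+ 2 * harmonic n| <= e by near: n; exact: h2.
    by rewrite sub0r normrN ger0_norm// mulr_ge0 ?divr_ge0 ?sqr_ge0 ?invr_ge0.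
  apply: le_trans n2; rewrite /bump -/q opprB addrCA subrr addr0.
  have := bump_den_ge1 n (q - n.+1%:R^-1); set s := 1 + _ => s1.
  rewrite ger0_norm ?invr_ge0; last lra.
  have n0 : (0 : R) < n.+1%:R by rewrite ltr0n.
  have -> : 4 / q ^+ 2 * n.+1%:R^-1 = (n.+1%:R * (q / 2) ^+ 2)^-1.
    by field; rewrite !gt_eqF.
  rewrite lef_pV2 ?posrE ?mulr_gt0 ?exprn_gt0//; try lra.
  apply: (@le_trans _ _ (n.+1%:R * sqpos (q - n.+1%:R^-1))).
    have uq : q / 2 <= q - n.+1%:R^-1.
      by rewrite lerBrDr -lerBrDl (le_trans (ltW n1))// lerBrDl -splitr.
    have q20 : 0 <= q / 2 by lra.
    rewrite ler_wpM2l ?ler0n// /sqpos max_r; last exact: le_trans uq.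
    by rewrite ler_sqr// nnegrE; exact: le_trans uq.
  by rewrite /s lerDr.
rewrite indicE (negbTE xab).
apply: cvg_near_cst; apply: nearW => n; apply: bump_out => //.
by move: xab; rewrite notin_setE.
Unshelve. all: by end_near. Qed.

Definition bump2 n (a b c d : R) (r : R * R) : R := bump n a b r.1 * bump n c d r.2.

Lemma test_fun_bump2 (U : set (R * R)) n a b c d : a < b -> c < d ->
  box a b c d `<=` U ->
  test_fun U (bump2 n a b c d).
Proof.
move=> ab cd BU.
have [p cp dp] := is_derive_bump n a b.
have [q cq dq] := is_derive_bump n c d.
have Dy r : is_derive r (ey R) (bump2 n a b c d) (p r.1 * bump n c d r.2).
  case: r => y z; apply/is_derive_ey; rewrite /bump2/=.
  have dpy := dp y; apply: is_derive_eq.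
  by rewrite /GRing.scale/=; ring.
have Dz r : is_derive r (ez R) (bump2 n a b c d) (bump n a b r.1 * q r.2).
  case: r => y z; apply/is_derive_ez; rewrite /bump2/=.
  have dqz := dq z; apply: is_derive_eq.
  by rewrite /GRing.scale/=; ring.
have cb a' b' : continuous (bump n a' b').
  have [p' _ dp'] := is_derive_bump n a' b' => x.
  by apply: differentiable_continuous; apply/derivable1_diffP; have [] := dp' x.
split.
- by move=> r; split; [have [] := Dy r|have [] := Dz r].
- have -> : 'D_(1, 0) (bump2 n a b c d) = fun r => p r.1 * bump n c d r.2.
    by apply/funext => r; have [] := Dy r.
  move=> r; apply: cvgM.
    by apply: (@continuous_comp _ _ _ fst p); [exact: cvg_fst|exact: cp].
  by apply: (@continuous_comp _ _ _ snd); [exact: cvg_snd|exact: cb].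
- have -> : 'D_(0, 1) (bump2 n a b c d) = fun r => bump n a b r.1 * q r.2.
    by apply/funext => r; have [] := Dz r.
  move=> r; apply: cvgM.
    by apply: (@continuous_comp _ _ _ fst); [exact: cvg_fst|exact: cb].
  by apply: (@continuous_comp _ _ _ snd q); [exact: cvg_snd|exact: cq].
have supp a' b' : a' < b' -> exists2 K : set R, compact K & K `<=` `]a', b'[%classic /\
    forall x, ~ K x -> bump n a' b' x = 0.
  move=> ab'.
  (* on ]a', b'[, x - a' <= e or b' - x <= e implies
     (x - a') (b' - x) <= e (b' - a') = 1/(n+1) *)
  pose e := (n.+1%:R * (b' - a'))^-1.
  have n0 : (0 : R) < n.+1%:R by rewrite ltr0n.
  have e0 : 0 < e by rewrite invr_gt0 mulr_gt0// subr_gt0.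
  exists `[a' + e, b' - e]%classic; first exact: segment_compact.
  split.
    move=> x /=; rewrite !in_itv/= => /andP[h1 h2]; apply/andP; split; lra.
  move=> x /=; rewrite in_itv/= => /negP h; apply: bump_eq0.
  have eE : e * (b' - a') = n.+1%:R^-1.
    by rewrite /e; field; rewrite addrC natr1 !gt_eqF// subr_gt0.
  rewrite -eE leNgt; apply/negP => h'; move/negP: h; apply.
  have p0 : 0 < e * (b' - a') by rewrite mulr_gt0// subr_gt0.
  have xa : a' < x by rewrite ltNge; apply/negP => ?; nra.
  have xb : x < b' by rewrite ltNge; apply/negP => ?; nra.
  by apply/andP; split; rewrite leNgt; apply/negP => ?; nra.
have [K cK [KI K0]] := supp a b ab; have [K' cK' [KI' K0']] := supp c d cd.
exists (K `*` K'); split.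
- exact: compact_setX.
- by move=> -[y z] [/= Ky Kz]; apply: BU; split; [exact: KI|exact: KI'].
- move=> -[y z] nK; rewrite /bump2/=.
  have [Ky|/K0 ->] := pselect (K y); last by rewrite mul0r.
  have [Kz|/K0' ->] := pselect (K' z); last by rewrite mulr0.
  by exfalso; apply: nK.
Qed.

Lemma bump2_le_indic n a b c d r : a < b -> c < d ->
  `|bump2 n a b c d r| <= \1_(box a b c d) r.
Proof.
move=> ab cd; have h1 := bump_bounds n a b r.1; have h2 := bump_bounds n c d r.2.
rewrite indicE; have [rB|rB] := boolP (r \in _).
  have [/andP[p0 p1] /andP[q0 q1]] := (h1, h2).
  by rewrite /bump2 ger0_norm ?mulr_ge0// mulr_ile1.
suff -> : bump2 n a b c d r = 0 by rewrite normr0.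
move: rB; rewrite notin_setE /box => nB; rewrite /bump2.
have [h|/(bump_out n ab) ->] := pselect (`]a, b[%classic r.1); last by rewrite mul0r.
have [h'|/(bump_out n cd) ->] := pselect (`]c, d[%classic r.2); last by rewrite mulr0.
by exfalso; apply: nB.
Qed.

Lemma cvg_bump2 a b c d r : a < b -> c < d ->
  bump2 n a b c d r @[n --> \oo] --> (\1_(box a b c d) r : R).
Proof.
move=> ab cd.
have -> : \1_(box a b c d) r =
    \1_(`]a, b[%classic) r.1 * \1_(`]c, d[%classic) r.2 :> R.
  by rewrite !indicE -natrM mulnb; congr ((nat_of_bool _)%:R); rewrite /box in_setX.
by apply: cvgM; exact: cvg_bump.
Qed.

End Bumps.

(** * The fundamental lemma of the calculus of variations *)
Section FundamentalLemma.
Variables (R : realType) (L : R).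
Notation T := (measurableTypeR R * measurableTypeR R)%type.
Notation S := (strip L : set T).
Notation mu := (@leb2 R).

Lemma test_fun_sqint (psi : R * R -> R) : test_fun (strip L) psi ->
  [/\ sqint mu S psi, sqint mu S ('D_((1, 0) : R * R) psi) &
      sqint mu S ('D_((0, 1) : R * R) psi)].
Proof.
move=> tpsi; have cpsi := test_fun_continuous tpsi.
have [_ cy cz [K [cK _ psi0]]] := tpsi.
have clK : closed K by apply: compact_closed => //; exact: norm_hausdorff.
have mS := measurable_strip L.
split.
- exact: (sqint_continuous mS cpsi cK psi0).
- exact: (sqint_continuous mS cy cK (fun r => @derive_off_support _ psi K _ r clK psi0)).
- exact: (sqint_continuous mS cz cK (fun r => @derive_off_support _ psi K _ r clK psi0)).
Qed.

Lemma box_sub_strip a b c d : - (L / 2) <= a -> b <= L / 2 ->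
  box a b c d `<=` strip L.
Proof.
move=> La bL [y z] [/= + _]; rewrite in_itv/= /strip/= ltr_norml => /andP[h1 h2].
by rewrite (le_lt_trans La)//= (lt_le_trans h2).
Qed.

Lemma sqint_indic_box a b c d : sqint mu S (\1_(box a b c d) : T -> R).
Proof.
apply: (@sqint_bounded_box _ _ _ 1 a b c d).
- exact: measurable_strip.
- by apply/measurable_indic; exact: measurable_box.
- by move=> r; rewrite indicE; case: (r \in _); rewrite ?normr1 ?normr0.
- by move=> r _ nB; rewrite indicE memNset.
Qed.

Variable f : R * R -> R.
Hypothesis Hf : sqint mu S f.
Hypothesis f0 : forall psi, test_fun (strip L) psi ->
  \int[mu]_(r in S) (f r * psi r) = 0.

Let mS := measurable_strip L.

Lemma integrable_box a b c d : - (L / 2) <= a -> b <= L / 2 ->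
  mu.-integrable (box a b c d) (EFin \o f).
Proof.
move=> La bL; have sub := @box_sub_strip a b c d La bL.
have mB := measurable_box a b c d.
have i1 := sqint_integrableM mS Hf (sqint_indic_box a b c d).
have i2 : mu.-integrable (box a b c d)
    (EFin \o (fun r => f r * \1_(box a b c d) r)) by exact: integrableS i1.
apply: eq_integrable i2 => // r rB /=.
by rewrite indicE rB mulr1.
Qed.

(** The bump functions of the box are dominated by its indicator and converge to
    it. *)
Lemma integral_box_eq0 a b c d : - (L / 2) <= a -> b <= L / 2 ->
  (\int[mu]_(r in box a b c d) (f r)%:E = 0)%E.
Proof.
move=> La bL; have sub := @box_sub_strip a b c d La bL.
have [ab|ba] := ltP a b; last first.
  rewrite (_ : box a b c d = set0) ?integral_set0//.
  by apply/seteqP; split => -[y z] //= [/= + _]; rewrite in_itv/=; lra.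
have [cd|dc] := ltP c d; last first.
  rewrite (_ : box a b c d = set0) ?integral_set0//.
  by apply/seteqP; split => -[y z] //= [/= _ +]; rewrite in_itv/=; lra.
have mB := measurable_box a b c d.
have [mf _] := Hf.
have -> : (\int[mu]_(r in box a b c d) (f r)%:E =
           \int[mu]_(r in S) (f r * \1_(box a b c d) r)%:E)%E.
  have -> : box a b c d = S `&` box a b c d by rewrite setIidr.
  rewrite integral_mkcondr; apply: eq_integral => r _.
  rewrite patchE indicE setIidr//.
  by case: ifP => _; rewrite ?mulr1 ?mulr0.
have mbump n : measurable_fun S (bump2 n a b c d : T -> R).
  by have [[]] := test_fun_sqint (test_fun_bump2 n ab cd sub).
have [|||||_ _] := @dominated_convergence _ _ _ mu S mS
  (fun n r => (f r * bump2 n a b c d r)%:E)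
  (fun r => (f r * \1_(box a b c d) r)%:E)
  (fun r => (`|f r| * \1_(box a b c d) r)%:E).
- by move=> n; apply/measurable_EFinP/measurable_funM.
- by apply/measurable_EFinP/measurable_funM => //; exact/measurable_indic.
- apply: aeW => r _; apply: cvg_EFin; first exact: nearW.
  by apply: cvgM; [exact: cvg_cst|exact: cvg_bump2].
- have [Hf' _] := sqint_abs Hf.
  exact: (sqint_integrableM mS Hf' (sqint_indic_box a b c d)).
- apply: aeW => r n _; rewrite /= lee_fin normrM ler_wpM2l//.
  exact: bump2_le_indic.
have z n : (\int[mu]_(r in S) (f r * bump2 n a b c d r)%:E = 0)%E.
  have tb := test_fun_bump2 n ab cd sub.
  have [sb _ _] := test_fun_sqint tb.
  have := f0 tb; rewrite /Rintegral => h.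
  by rewrite -[LHS]fineK ?h//; apply: integrable_fin_num => //; exact: sqint_integrableM.
under eq_fun do rewrite z.
by move=> /cvg_lim h; rewrite -h// lim_cst.
Qed.

(** The integrals of f over the measurable subsets of a box of full width vanish:
    by Dynkin's pi-lambda theorem it suffices to consider the boxes, on which the
    bump functions give the value. *)
Lemma ae_eq0_of_test : {ae mu, forall r, S r -> f r = 0}.
Proof.
pose D n := box (- (L / 2)) (L / 2) (- n%:R) (n%:R : R).
have mD n : measurable (D n) by exact: measurable_box.
have iD n : mu.-integrable (D n) (EFin \o f) by exact: integrable_box.
have intD n (A : set T) : measurable A -> (\int[mu]_(r in D n `&` A) (f r)%:E = 0)%E.
  rewrite measurable_boxes; move: A.
  apply: (@dynkin_induction _ T (@boxes R)
    (fun A => (\int[mu]_(r in D n `&` A) (f r)%:E = 0)%E)).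
  - exact: measurable_boxes.
  - exact: setI_closed_boxes.
  - by rewrite setIT; exact: integral_box_eq0.
  - move=> _ [a [b [c [d ->]]]].
    rewrite /D /box -setXI.
    rewrite (_ : _ `&` _ = `]Num.max (- (L / 2)) a, Num.min (L / 2) b[%classic); last first.
      apply/seteqP; split => x /=; rewrite !in_itv/= gt_max lt_min.
        by move=> [/andP[-> ->] /andP[-> ->]].
      by move=> /andP[/andP[-> ->] /andP[-> ->]].
    rewrite (_ : _ `&` `]c, d[%classic = `]Num.max (- n%:R) c, Num.min n%:R d[%classic); last first.
      apply/seteqP; split => x /=; rewrite !in_itv/= gt_max lt_min.
        by move=> [/andP[-> ->] /andP[-> ->]].
      by move=> /andP[/andP[-> ->] /andP[-> ->]].
    apply: integral_box_eq0; first by rewrite le_max lexx.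
    by rewrite ge_min lexx.
  - move=> A mA A0.
    have mf : measurable_fun (D n) (EFin \o f) := measurable_int _ (iD n).
    have DE : D n = (D n `&` A) `|` (D n `&` ~` A) by rewrite -setIUr setUCr setIT.
    have : (\int[mu]_(r in D n) (f r)%:E = 0)%E by exact: integral_box_eq0.
    rewrite {1}DE integral_setU ?A0 ?add0e//.
    - exact: measurableI.
    - by apply: measurableI => //; exact: measurableC.
    - by rewrite -DE.
    - by apply/disj_setPS => r [[_ ?] [_]].
  - move=> F mF tF F0; rewrite setI_bigcupr integral_bigcup//.
    + by apply: eseries0 => i _ _; exact: F0.
    + exact: trivIset_setIl.
    + by move=> k; exact: measurableI.
    + rewrite -setI_bigcupr; apply: integrableS (iD n) => //.
      by apply: measurableI => //; exact: bigcupT_measurable.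
have aeD n : {ae mu, forall r, D n r -> f r = 0}.
  have h : ae_eq mu (D n) (EFin \o f) (cst 0%E).
    apply: integral_ae_eq => //.
    move=> E ED mE; rewrite integral0 -(intD n E mE).
    by rewrite setIidr.
  by apply: filterS h => r /[apply] -[].
have := ae_foralln aeD; apply: filterS => r h Sr.
apply: (h (Num.bound r.2)); move: Sr; rewrite /strip/= ltr_norml => Sr.
split; rewrite /= in_itv//=.
by rewrite ltrNl unstable.ltrNbound unstable.ltr_bound.
Qed.

End FundamentalLemma.

(** * Weak derivatives and weak solutions on the strip *)
Section StripSobolev.
Variables (R : realType) (L : R).
Notation T := (measurableTypeR R * measurableTypeR R)%type.
Notation S := (strip L : set T).
Notation mu := (@leb2 R).
Implicit Types f g : R * R -> R[i].

Let mS := measurable_strip L.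

Lemma du_bois_reymond f : L2 S f ->
  (forall psi, test_fun (strip L) psi -> pairing L f psi = 0) ->
  {ae mu, forall r, S r -> f r = 0}.
Proof.
move=> Hf f0.
have [r1 _] := L2_Re Hf; have [i1 _] := L2_Im Hf.
have aR : {ae mu, forall r, S r -> Re (f r) = 0}.
  apply: (ae_eq0_of_test r1) => psi /f0; rewrite /pairing /cint => -[+ _].
  by move=> <-; apply: eq_Rintegral => r _; rewrite Re_mulc /= mulr0 subr0.
have aI : {ae mu, forall r, S r -> Im (f r) = 0}.
  apply: (ae_eq0_of_test i1) => psi /f0; rewrite /pairing /cint => -[_].
  by move=> <-; apply: eq_Rintegral => r _; rewrite Im_mulc /= mulr0 add0r.
by apply: filterS2 aR aI => r h1 h2 Sr; apply: complex_ext; rewrite ?h1 ?h2.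
Qed.

(** Completeness of L^2, applied to the real and the imaginary parts. *)
Lemma L2_series_cvg (f : nat -> R * R -> R[i]) (A : R) :
  (forall n, L2 S (f n)) -> (forall N, \sum_(n < N) L2norm L (f n) <= A) ->
  exists g, L2 S g /\
    L2norm L (fun r => \sum_(i < n) f i r - g r) @[n --> \oo] --> (0 : R).
Proof.
move=> Hf HA.
have [|N|gR [HR cR]] := @sqint_series_cvg _ _ _ mu S mS (fun n r => Re (f n r)) A.
- by move=> n; have [] := L2_Re (Hf n).
- apply: le_trans (HA N); apply: ler_sum => i _.
  by have [] := L2_Re (Hf i).
have [|N|gI [HI cI]] := @sqint_series_cvg _ _ _ mu S mS (fun n r => Im (f n r)) A.
- by move=> n; have [] := L2_Im (Hf n).
- apply: le_trans (HA N); apply: ler_sum => i _.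
  by have [] := L2_Im (Hf i).
pose g r := gR r +i* gI r.
have mg : cmeasurable L g by split; [case: HR|case: HI].
have sumRe n r : Re (\sum_(i < n) f i r) = \sum_(i < n) Re (f i r).
  by elim: n => [|n IH]; rewrite ?big_ord0// !big_ord_recr/= Re_addc IH.
have sumIm n r : Im (\sum_(i < n) f i r) = \sum_(i < n) Im (f i r).
  by elim: n => [|n IH]; rewrite ?big_ord0// !big_ord_recr/= Im_addc IH.
have dom (h : R * R -> R[i]) : cmeasurable L h ->
    sqint mu S (fun r => Re (h r)) -> sqint mu S (fun r => Im (h r)) ->
    L2 S h /\ L2norm L h <=
      sqnorm mu S (fun r => Re (h r)) + sqnorm mu S (fun r => Im (h r)).
  move=> mh hR hI; have [aR eR] := sqint_abs hR; have [aI eI] := sqint_abs hI.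
  have sD := sqintD mS aR aI.
  have [|h1 h2] := L2_dominated mh sD.
    apply: aeW => r _; rewrite [leRHS]ger0_norm ?addr_ge0//.
    exact: normc_le_ReIm.
  split => //; apply: (le_trans h2); rewrite -eR -eI.
  exact: sqnormD.
have Hg : L2 S g by have [] := dom g mg HR HI.
exists g; split => //.
apply: (@squeeze_cvgr _ _ _ _ (fun=> 0) (fun n =>
   sqnorm mu S (fun r => \sum_(i < n) Re (f i r) - gR r) +
   sqnorm mu S (fun r => \sum_(i < n) Im (f i r) - gI r))).
- apply: nearW => n; rewrite L2norm_ge0/=.
  have hs r : Re (\sum_(i < n) f i r - g r) = \sum_(i < n) Re (f i r) - gR r.
    by rewrite Re_addc Re_oppc sumRe.
  have hs' r : Im (\sum_(i < n) f i r - g r) = \sum_(i < n) Im (f i r) - gI r.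
    by rewrite Im_addc Im_oppc sumIm.
  have kR : sqint mu S (fun r => Re (\sum_(i < n) f i r - g r)).
    under eq_fun do rewrite hs.
    apply: (@sqintD _ _ _ _ _ mS _ (fun r => - gR r)).
      have [] // := @sqint_sum _ _ _ mu S mS (fun n r => Re (f n r)) n.
      by move=> i; have [] := L2_Re (Hf i).
    have [+ _] := sqintZ mS (-1) HR.
    by under eq_fun do rewrite mulN1r.
  have kI : sqint mu S (fun r => Im (\sum_(i < n) f i r - g r)).
    under eq_fun do rewrite hs'.
    apply: (@sqintD _ _ _ _ _ mS _ (fun r => - gI r)).
      have [] // := @sqint_sum _ _ _ mu S mS (fun n r => Im (f n r)) n.
      by move=> i; have [] := L2_Im (Hf i).
    have [+ _] := sqintZ mS (-1) HI.
    by under eq_fun do rewrite mulN1r.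
  have [|_] := dom _ _ kR kI.
    by split; [case: kR|case: kI].
  by rewrite -(funext hs) -(funext hs').
- exact: cvg_cst.
- by rewrite -[X in _ --> X](addr0 (0 : R)); apply: cvgD.
Qed.

Lemma pairing_sum (f : nat -> R * R -> R[i]) (h : R * R -> R) n :
  (forall i, L2 S (f i)) -> sqint mu S h ->
  pairing L (fun r => \sum_(i < n) f i r) h = \sum_(i < n) pairing L (f i) h /\
  L2 S (fun r => \sum_(i < n) f i r).
Proof.
move=> Hf Hh; elim: n => [|n [IH1 IH2]].
  have -> : (fun r => \sum_(i < 0) f i r) = fun=> 0.
    by apply/funext => r; rewrite big_ord0.
  have [h0 _] := L2_0 L; split => //.
  rewrite big_ord0 -[RHS](mul0r (pairing L (fun=> 0) h)) -pairingZl//.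
  by congr (pairing L _ h); apply/funext => r; rewrite mul0r.
have -> : (fun r => \sum_(i < n.+1) f i r) = (fun r => \sum_(i < n) f i r + f n r).
  by apply/funext => r; rewrite big_ord_recr.
split; last by have [] := L2D IH2 (Hf n).
by rewrite pairingDl// IH1 big_ord_recr.
Qed.

(** By [pairing_bound], a pairing with a fixed h is continuous in L^2. *)
Lemma pairing_limit (fn gn : nat -> R * R -> R[i]) f g (h k : R * R -> R) :
  (forall n, L2 S (fn n)) -> (forall n, L2 S (gn n)) -> L2 S f -> L2 S g ->
  sqint mu S h -> sqint mu S k ->
  L2norm L (fun r => fn n r - f r) @[n --> \oo] --> (0 : R) ->
  L2norm L (fun r => gn n r - g r) @[n --> \oo] --> (0 : R) ->
  (forall n, pairing L (fn n) h = - pairing L (gn n) k) ->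
  pairing L f h = - pairing L g k.
Proof.
move=> Hfn Hgn Hf Hg Hh Hk cf cg E.
have diff (p : R * R -> R[i]) (pn : nat -> R * R -> R[i]) (l : R * R -> R) n :
    L2 S (pn n) -> L2 S p -> sqint mu S l ->
    normc (pairing L (pn n) l - pairing L p l) <=
    2 * L2norm L (fun r => pn n r - p r) * sqnorm mu S l.
  move=> H1 H2 Hl; have [H3 _] := L2Z (-1) H2.
  have -> : pairing L (pn n) l - pairing L p l =
            pairing L (fun r => pn n r + -1 * p r) l.
    by rewrite pairingDl// pairingZl// mulN1r.
  have [H4 _] := L2D H1 H3; apply: (le_trans (pairing_bound H4 Hl)).
  by under eq_fun do rewrite mulN1r.
suff n0 : normc (pairing L f h + pairing L g k) = 0.
  by apply/eqP; rewrite -addr_eq0; apply/eqP; exact: ComplexField.Normc.eq0_normc.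
apply/eqP; rewrite eq_le normc_ge0 andbT.
set c := normc _.
pose b n := 2 * L2norm L (fun r => fn n r - f r) * sqnorm mu S h +
            2 * L2norm L (fun r => gn n r - g r) * sqnorm mu S k.
have cb : b n @[n --> \oo] --> (0 : R).
  have -> : (0 : R) = 2 * 0 * sqnorm mu S h + 2 * 0 * sqnorm mu S k.
    by rewrite !mulr0 !mul0r addr0.
  by apply: cvgD; apply: cvgM; first [exact: cvg_cst|
    apply: cvgM; [exact: cvg_cst|]].
have lb n : c <= b n.
  rewrite /c.
  have -> : pairing L f h + pairing L g k =
    - ((pairing L (fn n) h - pairing L f h) + (pairing L (gn n) k - pairing L g k)).
    by rewrite E; ring.
  rewrite normcN; apply: (le_trans (le_normcD _ _)); apply: lerD; exact: diff.
rewrite -(cvg_lim _ cb)//; apply: limr_ge; last exact: nearW.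
by apply/cvg_ex; exists 0.
Qed.

Lemma cint_setT (h : R * R -> R[i]) : (forall r, ~ S r -> h r = 0) ->
  cint setT h = cint S h.
Proof.
move=> h0; rewrite /cint.
congr (_ +i* _); rewrite [RHS]Rintegral_mkcond; apply: eq_Rintegral => r _;
  rewrite patchE; case: ifPn => // /negP rS; rewrite h0// => Sr; apply: rS;
  exact: mem_set.
Qed.

Lemma test_fun_setT (U : set (R * R)) psi : test_fun U psi -> test_fun setT psi.
Proof.
move=> [d cy cz [K [cK KU psi0]]]; split => //.
by exists K; split.
Qed.

Lemma test_fun_off (U : set (R * R)) psi r : test_fun U psi -> ~ U r ->
  [/\ psi r = 0, 'D_((1, 0) : R * R) psi r = 0 & 'D_((0, 1) : R * R) psi r = 0].
Proof.
move=> [_ _ _ [K [cK KU psi0]]] Ur.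
have clK : closed K by apply: compact_closed => //; exact: norm_hausdorff.
have Kr : ~ K r by move/KU.
by split; [exact: psi0|exact: (derive_off_support _ clK)|exact: (derive_off_support _ clK)].
Qed.

Lemma weak_solution_pairing (w : jet R) (a : R[i]) (c h : R * R -> R[i]) psi :
  L2 S (fdy w) -> L2 S (fdz w) -> L2 S (fun r => c r * fval w r) -> L2 S h ->
  weak_solution w a c h -> test_fun (strip L) psi ->
  pairing L h psi =
  - (pairing L (fdy w) ('D_((1, 0) : R * R) psi)
     + pairing L (fdz w) ('D_((0, 1) : R * R) psi))
  + (a * pairing L (fdy w) psi + pairing L (fun r => c r * fval w r) psi).
Proof.
move=> Hy Hz Hc Hh ws tpsi.
have := ws psi (test_fun_setT tpsi).
rewrite !cint_setT; last 2 first.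
- by move=> r /(test_fun_off tpsi) [-> _ _]; rewrite rmorph0 mulr0.
- by move=> r /(test_fun_off tpsi) [-> -> ->]; rewrite !rmorph0 !(mulr0, addr0, oppr0).
rewrite -/(pairing L h psi) => <-.
have [sp sy sz] := test_fun_sqint tpsi.
have i1 := pairing_integrable Hy sy; have i2 := pairing_integrable Hz sz.
have i3 := pairing_integrable Hy sp; have i4 := pairing_integrable Hc sp.
have [i12 e12] := cintegrableD i1 i2.
have [i12' e12'] := cintegrableZ (-1) i12.
have [i3' e3'] := cintegrableZ a i3.
have [i34 e34] := cintegrableD i3' i4.
have [_ e] := cintegrableD i12' i34.
rewrite -[- (_ + _)]mulN1r /pairing -e12 -e12' -e3' -e34 -e.
have ring_id (x y p q a' s t : R[i]) :
    - (x * p + y * q) + (a' * x + s) * t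
    = -1 * (x * p + y * q) + (a' * (x * t) + s * t) by ring.
by congr cint; apply/funext => r; exact: ring_id.
Qed.

Lemma test_fun_mul_y (U : set (R * R)) psi (p dp : R -> R) :
  (forall y, is_derive y (1 : R) p (dp y)) -> continuous dp ->
  test_fun U psi ->
  test_fun U (fun r => p r.1 * psi r) /\
  (forall r, 'D_((1, 0) : R * R) (fun r => p r.1 * psi r) r =
             p r.1 * 'D_((1, 0) : R * R) psi r + dp r.1 * psi r) /\
  (forall r, 'D_((0, 1) : R * R) (fun r => p r.1 * psi r) r =
             p r.1 * 'D_((0, 1) : R * R) psi r).
Proof.
move=> Dp cdp tpsi; have cpsi := test_fun_continuous tpsi.
have [dpsi cy cz [K [cK KU psi0]]] := tpsi.
have cp : continuous p.
  by move=> y; apply: differentiable_continuous; apply/derivable1_diffP; have [] := Dp y.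
have Ey r : is_derive r (ey R) (fun r => p r.1 * psi r)
    (p r.1 * 'D_((1, 0) : R * R) psi r + dp r.1 * psi r).
  case: r => y z; apply/is_derive_ey => /=.
  have d1 := Dp y.
  have d2 : is_derive y (1 : R) (fun t : R => psi (t, z)) ('D_((1, 0) : R * R) psi (y, z)).
    by apply/is_derive_ey; exact: (derivableP (dpsi (y, z)).1).
  by apply: is_derive_eq; rewrite /GRing.scale/=; ring.
have Ez r : is_derive r (ez R) (fun r => p r.1 * psi r)
    (p r.1 * 'D_((0, 1) : R * R) psi r).
  case: r => y z; apply/is_derive_ez => /=.
  have d2 : is_derive z (1 : R) (fun t : R => psi (y, t)) ('D_((0, 1) : R * R) psi (y, z)).
    by apply/is_derive_ez; exact: (derivableP (dpsi (y, z)).2).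
  by apply: is_derive_eq; rewrite /GRing.scale/=; ring.
have eqy r : 'D_((1, 0) : R * R) (fun r => p r.1 * psi r) r =
             p r.1 * 'D_((1, 0) : R * R) psi r + dp r.1 * psi r by have [] := Ey r.
have eqz r : 'D_((0, 1) : R * R) (fun r => p r.1 * psi r) r =
             p r.1 * 'D_((0, 1) : R * R) psi r by have [] := Ez r.
have c1 (q : R -> R) : continuous q -> continuous (fun r : R * R => q r.1).
  by move=> cq r; apply: (@continuous_comp _ _ _ fst q); [exact: cvg_fst|exact: cq].
split; [split|by split].
- by move=> r; split; [have [] := Ey r|have [] := Ez r].
- rewrite (_ : 'D_((1, 0) : R * R) _ = fun r =>
    p r.1 * 'D_((1, 0) : R * R) psi r + dp r.1 * psi r); last exact/funext.
  by move=> r; apply: cvgD; apply: cvgM;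
    [exact: c1|exact: cy|exact: c1|exact: cpsi].
- rewrite (_ : 'D_((0, 1) : R * R) _ = fun r => p r.1 * 'D_((0, 1) : R * R) psi r);
    last exact/funext.
  by move=> r; apply: cvgM; [exact: c1|exact: cz].
- by exists K; split => // r /psi0 ->; rewrite mulr0.
Qed.

Lemma pairing_expi f (b : R) (h : R * R -> R) : L2 S f ->
  measurable_fun S (h : T -> R) -> sqint mu S h ->
  [/\ sqint mu S (fun r => cos (b * r.1) * h r),
      sqint mu S (fun r => sin (b * r.1) * h r) &
  pairing L (fun r => f r * expi (b * r.1)) h =
  pairing L f (fun r => cos (b * r.1) * h r)
  + ci * pairing L f (fun r => sin (b * r.1) * h r)].
Proof.
move=> Hf mh Hh.
have [mc ms] := cmeasurable_expi L b.
have sc : sqint mu S (fun r => cos (b * r.1) * h r).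
  have m1 : measurable_fun S (fun r => cos (b * r.1) * h r).
    exact: (measurable_funM mc mh).
  have [] // := sqint_le mS m1 Hh; apply: aeW => r _; rewrite normrM ler_piMl//.
  by rewrite ler_norml cos_geN1 cos_le1.
have ss : sqint mu S (fun r => sin (b * r.1) * h r).
  have m1 : measurable_fun S (fun r => sin (b * r.1) * h r).
    exact: (measurable_funM ms mh).
  have [] // := sqint_le mS m1 Hh; apply: aeW => r _; rewrite normrM ler_piMl//.
  by rewrite ler_norml sin_geN1 sin_le1.
split => //.
have [i1 e1] := cintegrableZ ci (pairing_integrable Hf ss).
have [_ e2] := cintegrableD (pairing_integrable Hf sc) i1.
rewrite /pairing -e1 -e2; congr cint; apply/funext => r.
rewrite !rmorphM /=.
have -> : expi (b * r.1) = (cos (b * r.1))%:C + ci * (sin (b * r.1))%:C :> R[i].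
  by apply: complex_ext; rewrite ?Re_addc ?Im_addc ?Re_mulc ?Im_mulc /=; ring.
by ring.
Qed.

(** The phase is moved onto the test function: psi is replaced by cos(b y) psi
    and sin(b y) psi, whose derivatives produce the additional term i b w. *)
Lemma H1_phase (b : R) (w : jet R) : H1 L w -> H1 L (phase b w).
Proof.
move=> [H0 Hy Hz wg]; split => /=.
- exact: L2_expi.
- apply: L2_expi; have [h1 _] := L2Z (ci * b%:C) H0.
  by have [] := L2D Hy h1.
- exact: L2_expi.
move=> psi tpsi.
have [sp sy sz] := test_fun_sqint tpsi.
have dcos y : is_derive y (1 : R) (fun t => cos (b * t)) (- (b * sin (b * y))).
  have := is_derive_cos (b * y).
  have h1 : is_derive y (1 : R) (fun t => b * t) b.
    by apply: is_derive_eq; rewrite /GRing.scale/=; ring.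
  move=> h2; have := @is_derive1_comp _ (@cos R) (fun t => b * t) y _ _ h2 h1.
  by move=> h; apply: is_derive_eq h _; ring.
have dsin y : is_derive y (1 : R) (fun t => sin (b * t)) (b * cos (b * y)).
  have := is_derive_sin (b * y).
  have h1 : is_derive y (1 : R) (fun t => b * t) b.
    by apply: is_derive_eq; rewrite /GRing.scale/=; ring.
  move=> h2; have := @is_derive1_comp _ (@sin R) (fun t => b * t) y _ _ h2 h1.
  by move=> h; apply: is_derive_eq h _; ring.
have cb : continuous (fun t : R => b * t).
  by move=> t; apply: cvgM; [exact: cvg_cst|exact: cvg_id].
have cdc : continuous (fun y : R => - (b * sin (b * y))).
  move=> y; apply: cvgN; apply: cvgM; first exact: cvg_cst.
  by apply: (@continuous_comp _ _ _ (fun t => b * t) (@sin R)); [exact: cb|exact: continuous_sin].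
have cds : continuous (fun y : R => b * cos (b * y)).
  move=> y; apply: cvgM; first exact: cvg_cst.
  by apply: (@continuous_comp _ _ _ (fun t => b * t) (@cos R)); [exact: cb|exact: continuous_cos].
have [tc [cy cz]] := test_fun_mul_y dcos cdc tpsi.
have [ts [sny snz]] := test_fun_mul_y dsin cds tpsi.
have wcy : pairing L (fval w) _ = - pairing L (fdy w) _ := (wg _ tc).1.
have wcz : pairing L (fval w) _ = - pairing L (fdz w) _ := (wg _ tc).2.
have wsy : pairing L (fval w) _ = - pairing L (fdy w) _ := (wg _ ts).1.
have wsz : pairing L (fval w) _ = - pairing L (fdz w) _ := (wg _ ts).2.
have [mp my mz] : [/\ measurable_fun S (psi : T -> R),
    measurable_fun S ('D_((1, 0) : R * R) psi : T -> R) &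
    measurable_fun S ('D_((0, 1) : R * R) psi : T -> R)].
  by split; [case: sp|case: sy|case: sz].
have [H1' _] := L2Z (ci * b%:C) H0; have [H2' _] := L2D Hy H1'.
have [sc0 ss0 e0] := pairing_expi b H0 mp sp.
have [scy ssy ey] := pairing_expi b H0 my sy.
have [scz ssz ez] := pairing_expi b H0 mz sz.
have [_ _ eyy] := pairing_expi b Hy mp sp.
have [_ _ ezz] := pairing_expi b Hz mp sp.
have [_ _ e2] := pairing_expi b H2' mp sp.
split.
- rewrite [LHS]ey [X in _ = - X]e2.
  have kc : pairing L (fval w) (fun r => cos (b * r.1) * 'D_((1, 0) : R * R) psi r) =
      - pairing L (fdy w) (fun r => cos (b * r.1) * psi r)
      + b%:C * pairing L (fval w) (fun r => sin (b * r.1) * psi r).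
    rewrite -wcy -pairingZr//.
    have [tcp tcy _] := test_fun_sqint tc.
    have bs : sqint mu S (fun r => b * (sin (b * r.1) * psi r)).
      by have [] := sqintZ mS b ss0.
    rewrite -pairingDr//; congr pairing; apply/funext => r.
    by rewrite cy; ring.
  have ks : pairing L (fval w) (fun r => sin (b * r.1) * 'D_((1, 0) : R * R) psi r) =
      - pairing L (fdy w) (fun r => sin (b * r.1) * psi r)
      - b%:C * pairing L (fval w) (fun r => cos (b * r.1) * psi r).
    rewrite -wsy -mulNr -rmorphN -pairingZr//.
    have [tsp tsy _] := test_fun_sqint ts.
    have bs : sqint mu S (fun r => - b * (cos (b * r.1) * psi r)).
      by have [] := sqintZ mS (- b) sc0.
    rewrite -pairingDr//; congr pairing; apply/funext => r.
    by rewrite sny; ring.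
  rewrite kc ks !pairingDl// !pairingZl//.
  have ci2 : ci * ci = -1 :> R[i].
    by apply: complex_ext; rewrite ?Re_mulc ?Im_mulc ?Re_oppc ?Im_oppc /=; ring.
  set a1 := pairing L (fdy w) _; set a2 := pairing L (fval w) _.
  set a3 := pairing L (fdy w) _; set a4 := pairing L (fval w) _.
  have -> : - (a1 + ci * b%:C * a4 + ci * (a3 + ci * b%:C * a2)) =
    - a1 - ci * a3 - ci * b%:C * a4 - (ci * ci) * b%:C * a2 by ring.
  by rewrite ci2; ring.
- rewrite [LHS]ez [X in _ = - X]ezz.
  have kc : pairing L (fval w) (fun r => cos (b * r.1) * 'D_((0, 1) : R * R) psi r) =
      - pairing L (fdz w) (fun r => cos (b * r.1) * psi r).
    by rewrite -wcz; congr pairing; apply/funext => r; rewrite cz.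
  have ks : pairing L (fval w) (fun r => sin (b * r.1) * 'D_((0, 1) : R * R) psi r) =
      - pairing L (fdz w) (fun r => sin (b * r.1) * psi r).
    by rewrite -wsz; congr pairing; apply/funext => r; rewrite snz.
  by rewrite kc ks; ring.
Qed.

End StripSobolev.

(** * Estimates for the perturbation sequences *)
Section Estimates.
Variables (R : realType) (L : R).
Notation T := (measurableTypeR R * measurableTypeR R)%type.
Notation S := (strip L : set T).
Notation mu := (@leb2 R).

Lemma ae_imp (P Q : T -> Prop) : {ae mu, forall r, P r} ->
  (forall r, P r -> Q r) -> {ae mu, forall r, Q r}.
Proof. by move=> h PQ; apply: filterS h. Qed.

Lemma H1norm_ge0 (w : jet R) : 0 <= H1norm L w.
Proof. exact: sqrtr_ge0. Qed.

Lemma L2norm_le_H1norm (w : jet R) :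
  [/\ L2norm L (fval w) <= H1norm L w, L2norm L (fdy w) <= H1norm L w &
      L2norm L (fdz w) <= H1norm L w].
Proof.
have s0 (x : R) := sqr_ge0 x.
split; rewrite /H1norm -[leLHS]ger0_norm ?L2norm_ge0// -sqrtr_sqr ler_wsqrtr//.
- by rewrite -addrA lerDl addr_ge0.
- by rewrite addrAC lerDr addr_ge0.
- by rewrite lerDr addr_ge0.
Qed.

Lemma H1norm_le_sum (w : jet R) :
  H1norm L w <= L2norm L (fval w) + L2norm L (fdy w) + L2norm L (fdz w).
Proof.
have := L2norm_ge0 L (fval w); have := L2norm_ge0 L (fdy w).
have := L2norm_ge0 L (fdz w).
rewrite /H1norm; set a := L2norm L (fval w); set b := L2norm L (fdy w).
set c := L2norm L (fdz w) => c0 b0 a0.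
have s0 : 0 <= a + b + c by rewrite !addr_ge0.
rewrite -[leRHS]ger0_norm// -sqrtr_sqr ler_wsqrtr//; nra.
Qed.

Lemma cint_cmeasurable (f : R * R -> R[i]) : cintegrable S f -> cmeasurable L f.
Proof.
by move=> [f1 f2]; split; apply/measurable_EFinP;
  [exact: measurable_int f1|exact: measurable_int f2].
Qed.

(** If every determinant vanished, then, for psi1 with <f2, psi1> <> 0 and
    c = <f1, psi1> / <f2, psi1>, the function f1 - c f2 would be annihilated by
    all test functions. *)
Lemma separating_tests (f1 f2 : R * R -> R[i]) : L2 S f1 -> L2 S f2 ->
  ~ {ae mu, forall r, S r -> f2 r = 0} ->
  (forall c : R[i], ~ {ae mu, forall r, S r -> f1 r = c * f2 r}) ->
  exists psi1 psi2, [/\ test_fun (strip L) psi1, test_fun (strip L) psi2 &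
    pairing L f1 psi1 * pairing L f2 psi2
    - pairing L f1 psi2 * pairing L f2 psi1 <> 0].
Proof.
move=> H1 H2 n2 n12.
have [psi1 t1 q1] : exists2 psi, test_fun (strip L) psi & pairing L f2 psi <> 0.
  apply: contrapT => h; apply: n2; apply: du_bois_reymond => // psi tp.
  by apply: contrapT => hp; apply: h; exists psi.
apply: contrapT => h.
pose c := pairing L f1 psi1 / pairing L f2 psi1.
apply: (n12 c).
have [H3 _] := L2Z (- c) H2; have [H4 _] := L2D H1 H3.
have : {ae mu, forall r, S r -> f1 r + - c * f2 r = 0}.
  apply: du_bois_reymond => // psi tp.
  have [sp _ _] := test_fun_sqint tp.
  rewrite pairingDl// pairingZl//.
  have : pairing L f1 psi1 * pairing L f2 psi - pairing L f1 psi * pairing L f2 psi1 = 0.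
    by apply: contrapT => hp; apply: h; exists psi1, psi.
  move/eqP; rewrite subr_eq0 => /eqP e.
  apply: (mulIf (introN eqP q1)); rewrite mul0r /c mulrDl -e.
  rewrite mulNr mulNr mulrAC divfK ?subrr//; exact/eqP.
by apply: filterS => r /[apply] /eqP; rewrite mulNr subr_eq0 => /eqP.
Qed.

Lemma cramer_bound (t s : R) (p1 q1 p2 q2 : R[i]) (E : R) :
  p1 * q2 - p2 * q1 <> 0 ->
  normc (t%:C * p1 + s%:C * q1) <= E -> normc (t%:C * p2 + s%:C * q2) <= E ->
  `|t| + `|s| <= E * ((normc p1 + normc q1 + normc p2 + normc q2) /
                      normc (p1 * q2 - p2 * q1)).
Proof.
set D := p1 * q2 - p2 * q1 => D0.
set e1 := t%:C * p1 + _; set e2 := t%:C * p2 + _ => h1 h2.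
have D1 : 0 < normc D.
  rewrite lt0r normc_ge0 andbT; apply/eqP => /ComplexField.Normc.eq0_normc.
  exact: D0.
rewrite mulrA ler_pdivlMr// mulrDl.
have -> : `|t| * normc D = normc (e1 * q2 + - (e2 * q1)).
  rewrite -normcR -ComplexField.Normc.normcM; congr normc.
  by rewrite /D /e1 /e2; ring.
have -> : `|s| * normc D = normc (e2 * p1 + - (e1 * p2)).
  rewrite -normcR -ComplexField.Normc.normcM; congr normc.
  by rewrite /D /e1 /e2; ring.
have a1 := le_normcD (e1 * q2) (- (e2 * q1)).
have a2 := le_normcD (e2 * p1) (- (e1 * p2)).
rewrite !normcN !ComplexField.Normc.normcM in a1 a2.
apply: (le_trans (lerD a1 a2)).
have b1 := ler_wpM2r (normc_ge0 q2) h1; have b2 := ler_wpM2r (normc_ge0 q1) h2.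
have b3 := ler_wpM2r (normc_ge0 p1) h2; have b4 := ler_wpM2r (normc_ge0 p2) h1.
lra.
Qed.

Lemma L2_mul_Linfty (h : R * R -> R) (f : R * R -> R[i]) (M : R) :
  measurable_fun (setT : set T) h -> {ae mu, forall r, `|h r| <= M} -> 0 <= M ->
  L2 S f ->
  L2 S (fun r => (h r)%:C * f r) /\
  L2norm L (fun r => (h r)%:C * f r) <= M * L2norm L f.
Proof.
move=> mh hM M0 Hf; apply: L2_mul_bounded => //.
  by apply: cmeasurableR; exact: measurable_funTS.
by apply: (ae_imp hM) => r hr _; rewrite normcR.
Qed.

(** Term by term; every norm and every coefficient that occurs in D_j is at most
    the corresponding X_i, up to a constant. *)
Lemma Dseq_L2 (eps F : R * R -> R) (beta Me MF : R) (phi : nat -> jet R)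
    (tau g : nat -> R) (j : nat) :
  measurable_fun (setT : set T) eps -> {ae mu, forall r, `|eps r| <= Me} ->
  0 <= Me ->
  measurable_fun (setT : set T) F -> {ae mu, forall r, `|F r| <= MF} ->
  0 <= MF -> (forall i, H1 L (phi i)) ->
  let X i := H1norm L (phi i) + `|tau i| + `|g i| in
  L2 S (Dseq eps F beta phi tau g j) /\
  L2norm L (Dseq eps F beta phi tau g j) <= (MF + Me + 2 * `|beta| + 3) *
    (\sum_(1 <= n < j.+1) X n.-1 * X (j - n)%N
     + \sum_(2 <= n < j.+1) \sum_(1 <= m < n) X m * X (n - m)%N * X (j - n)%N
     + \sum_(1 <= n < j) X n * X (j - n)%N).
Proof.
move=> meps eM Me0 mF FM MF0 Hphi X.
have X0 i : 0 <= X i by rewrite !addr_ge0// H1norm_ge0.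
have aX i : H1norm L (phi i) <= X i by rewrite /X -addrA lerDl addr_ge0.
have tX i : `|tau i| <= X i by rewrite /X addrAC lerDr addr_ge0// H1norm_ge0.
have gX i : `|g i| <= X i by rewrite /X lerDr addr_ge0// H1norm_ge0.
have b0 : 0 <= `|beta| by [].
have fX i : L2norm L (fval (phi i)) <= X i.
  by have [h _ _] := L2norm_le_H1norm (phi i); exact: le_trans h (aX i).
have dX i : L2norm L (fdy (phi i)) <= X i.
  by have [_ h _] := L2norm_le_H1norm (phi i); exact: le_trans h (aX i).
have Hf i : L2 S (fval (phi i)) by have [] := Hphi i.
have Hd i : L2 S (fdy (phi i)) by have [] := Hphi i.
have aux (M : R) (h : T -> R) : {ae mu, forall r, `|h r| <= M} -> forall c : R,
    {ae mu, forall r, `|c * h r| <= `|c| * M}.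
  by move=> hM c; apply: (ae_imp hM) => r hr; rewrite normrM ler_wpM2l.
have [|A1 A2] := @L2_sum R L
  (fun n r => (g n.-1 * F r)%:C * fval (phi (j - n)%N) r)
  (fun n => MF * (X n.-1 * X (j - n)%N)) 1 j.+1.
  move=> n _.
  have mgF : measurable_fun (setT : set T) (fun r => g n.-1 * F r).
    exact: measurable_funM.
  have gMF : 0 <= `|g n.-1| * MF by rewrite mulr_ge0.
  have [h1 h2] := L2_mul_Linfty mgF (aux _ _ FM _) gMF (Hf (j - n)%N).
  split => //; apply: (le_trans h2); rewrite mulrA [MF * _]mulrC.
  by rewrite ler_pM ?L2norm_ge0// ler_wpM2r.
have [|B1 B2] := @L2_sum R L
  (fun n r => \sum_(1 <= m < n) (tau m * tau (n - m)%N)%:C * fval (phi (j - n)%N) r)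
  (fun n => \sum_(1 <= m < n) X m * X (n - m)%N * X (j - n)%N) 2 j.+1.
  move=> n _; apply: L2_sum => m _.
  have [h1 h2] := L2Z (tau m * tau (n - m)%N)%:C (Hf (j - n)%N).
  split => //; apply: (le_trans h2); rewrite normcR normrM.
  by rewrite ler_pM ?mulr_ge0 ?L2norm_ge0// ler_pM.
have [|C1 C2] := @L2_sum R L
  (fun n r => (g n * eps r - 2 * beta * tau n)%:C * fval (phi (j - n)%N) r
       + 2 * ci * (tau n)%:C * fdy (phi (j - n)%N) r)
  (fun n => (Me + 2 * `|beta| + 2) * (X n * X (j - n)%N)) 1 j.
  move=> n _.
  have mge : measurable_fun (setT : set T) (fun r => g n * eps r - 2 * beta * tau n).
    by apply: measurable_funB => //; exact: measurable_funM.
  have bnd : {ae mu, forall r, `|g n * eps r - 2 * beta * tau n| <=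
      (Me + 2 * `|beta|) * X n}.
    apply: (ae_imp eM) => r er; apply: (le_trans (ler_normB _ _)).
    rewrite !normrM [`|2|]ger0_norm// [leRHS]mulrDl; apply: lerD.
      by rewrite mulrC ler_pM.
    by rewrite ler_wpM2l// mulr_ge0.
  have MX : 0 <= (Me + 2 * `|beta|) * X n.
    by rewrite mulr_ge0// addr_ge0// mulr_ge0.
  have [h1 h2] := L2_mul_Linfty mge bnd MX (Hf (j - n)%N).
  have [k1 k2] := L2Z (2 * ci * (tau n)%:C) (Hd (j - n)%N).
  have [l1 l2] := L2D h1 k1; split => //; apply: (le_trans l2).
  have -> : (Me + 2 * `|beta| + 2) * (X n * X (j - n)%N) =
    (Me + 2 * `|beta|) * X n * X (j - n)%N + 2 * X n * X (j - n)%N by ring.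
  apply: lerD; first by apply: (le_trans h2); rewrite ler_wpM2l.
  apply: (le_trans k2); rewrite !ComplexField.Normc.normcM normc_ci mulr1 normcR.
  have -> : normc (2 : R[i]) = 2 :> R by have := @normcR R 2; rewrite rmorph_nat ger0_norm.
  by rewrite ler_pM ?mulr_ge0 ?L2norm_ge0// ler_wpM2l.
have [B1' B2'] := L2Z (-1) B1.
have [AB1 AB2] := L2D A1 B1'; have [D1 D2] := L2D AB1 C1.
have DE : Dseq eps F beta phi tau g j = (fun r =>
  (\sum_(1 <= n < j.+1) (g n.-1 * F r)%:C * fval (phi (j - n)%N) r
  + -1 * \sum_(2 <= n < j.+1) \sum_(1 <= m < n)
      (tau m * tau (n - m)%N)%:C * fval (phi (j - n)%N) r)
  + \sum_(1 <= n < j)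
      ((g n * eps r - 2 * beta * tau n)%:C * fval (phi (j - n)%N) r
       + 2 * ci * (tau n)%:C * fdy (phi (j - n)%N) r)).
  by apply/funext => r; rewrite /Dseq mulN1r.
rewrite DE; split => //; apply: (le_trans D2).
have N1 : normc (-1 : R[i]) = 1 by rewrite normcN normcR normr1.
rewrite N1 mul1r in B2'.
apply: (le_trans (lerD (le_trans AB2 (lerD A2 (le_trans B2' B2))) C2)).
rewrite -!mulr_sumr.
have s1 : 0 <= \sum_(1 <= n < j.+1) X n.-1 * X (j - n)%N.
  by apply: sumr_ge0 => n _; rewrite mulr_ge0.
have s2 : 0 <= \sum_(2 <= n < j.+1) \sum_(1 <= m < n) X m * X (n - m)%N * X (j - n)%N.
  by apply: sumr_ge0 => n _; apply: sumr_ge0 => m _; rewrite !mulr_ge0.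
have s3 : 0 <= \sum_(1 <= n < j) X n * X (j - n)%N.
  by apply: sumr_ge0 => n _; rewrite mulr_ge0.
move: s1 s2 s3; set x1 := \sum_(_ <= _ < _) _; set x2 := \sum_(_ <= _ < _) _.
set x3 := \sum_(_ <= _ < _) _ => s1 s2 s3.
clear -s1 s2 s3 Me0 MF0 b0; nra.
Qed.

End Estimates.

(** * Convergence of the perturbation series *)
Section Convergence.
Variables (R : realType) (L : R).
Notation T := (measurableTypeR R * measurableTypeR R)%type.
Notation S := (strip L : set T).
Notation mu := (@leb2 R).

Lemma abs_series_cvg (c : nat -> R) (delta rho A : R) : `|delta| <= rho ->
  (forall N, \sum_(j < N) `|c j| * rho ^+ j <= A) ->
  cvgn (series (fun j => c j * delta ^+ j)).
Proof.
move=> dr HA; apply: normed_cvg; apply: nondecreasing_is_cvgn.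
  by apply: nondecreasing_series => n _ _; rewrite /= normr_ge0.
exists A => _ [n _ <-]; rewrite /normed_series_of seriesEord.
apply: le_trans (HA n); apply: ler_sum => j _.
by rewrite /= normrM normrX ler_wpM2l// lerXn2r// nnegrE (le_trans _ dr).
Qed.

(** The functions and their two weak derivatives converge separately in L^2;
    [pairing_limit] shows that the limits of the derivatives are the weak
    derivatives of the limit. *)
Lemma H1_series_cvg (phi : nat -> jet R) (delta rho A : R) : `|delta| <= rho ->
  (forall j, H1 L (phi j)) ->
  (forall N, \sum_(j < N) H1norm L (phi j) * rho ^+ j <= A) ->
  H1_convergent L (jet_psum delta phi).
Proof.
move=> dr Hphi HA.
have lim (comp : jet R -> R * R -> R[i]) :
    (forall j, L2 S (comp (phi j))) ->
    (forall j, L2norm L (comp (phi j)) <= H1norm L (phi j)) ->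
    (forall j, L2 S (fun r => (delta ^+ j)%:C * comp (phi j) r)) /\
    exists g, L2 S g /\ L2norm L (fun r =>
     \sum_(i < n) (delta ^+ i)%:C * comp (phi i) r - g r) @[n --> \oo] --> (0 : R).
  move=> H1' H2'.
  have Z j := L2Z (delta ^+ j)%:C (H1' j).
  split; first by move=> j; have [] := Z j.
  apply: (@L2_series_cvg R L (fun j r => (delta ^+ j)%:C * comp (phi j) r) A).
    by move=> j; have [] := Z j.
  move=> N; apply: le_trans (HA N); apply: ler_sum => j _.
  have [_ h] := Z j; apply: (le_trans h); rewrite normcR normrX mulrC.
  by rewrite ler_pM ?L2norm_ge0 ?exprn_ge0// lerXn2r// nnegrE (le_trans _ dr).
have [l0 [g0 [G0 c0]]] := lim (@fval R)
  (fun j => let: And4 h _ _ _ := Hphi j in h)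
  (fun j => let: And3 h _ _ := L2norm_le_H1norm L (phi j) in h).
have [ly [gy [Gy cy]]] := lim (@fdy R)
  (fun j => let: And4 _ h _ _ := Hphi j in h)
  (fun j => let: And3 _ h _ := L2norm_le_H1norm L (phi j) in h).
have [lz [gz [Gz cz]]] := lim (@fdz R)
  (fun j => let: And4 _ _ h _ := Hphi j in h)
  (fun j => let: And3 _ _ h := L2norm_le_H1norm L (phi j) in h).
exists (Jet g0 gy gz); split.
  split => // psi tpsi.
  have [sp sy sz] := test_fun_sqint tpsi.
  split.
  - change (pairing L g0 ('D_((1, 0) : R * R) psi) = - pairing L gy psi).
    apply: (pairing_limit _ _ G0 Gy sy sp c0 cy).
    + by move=> n; have [] := pairing_sum n l0 sy.
    + by move=> n; have [] := pairing_sum n ly sp.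
    + move=> n; have [-> _] := pairing_sum n l0 sy.
      have [-> _] := pairing_sum n ly sp; rewrite -sumrN; apply: eq_bigr => i _.
      have [H0 Hy _ wg] := Hphi i.
      rewrite (pairingZl _ H0 sy) (pairingZl _ Hy sp).
      have e : pairing L (fval (phi i)) _ = - pairing L (fdy (phi i)) _ := (wg _ tpsi).1.
      by rewrite e mulrN.
  - change (pairing L g0 ('D_((0, 1) : R * R) psi) = - pairing L gz psi).
    apply: (pairing_limit _ _ G0 Gz sz sp c0 cz).
    + by move=> n; have [] := pairing_sum n l0 sz.
    + by move=> n; have [] := pairing_sum n lz sp.
    + move=> n; have [-> _] := pairing_sum n l0 sz.
      have [-> _] := pairing_sum n lz sp; rewrite -sumrN; apply: eq_bigr => i _.
      have [H0 _ Hz wg] := Hphi i.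
      rewrite (pairingZl _ H0 sz) (pairingZl _ Hz sp).
      have e : pairing L (fval (phi i)) _ = - pairing L (fdz (phi i)) _ := (wg _ tpsi).2.
      by rewrite e mulrN.
apply: (@squeeze_cvgr _ _ _ _ (fun=> 0) (fun n =>
  L2norm L (fun r => \sum_(i < n) (delta ^+ i)%:C * fval (phi i) r - g0 r)
  + L2norm L (fun r => \sum_(i < n) (delta ^+ i)%:C * fdy (phi i) r - gy r)
  + L2norm L (fun r => \sum_(i < n) (delta ^+ i)%:C * fdz (phi i) r - gz r))).
- by apply: nearW => n; rewrite H1norm_ge0; exact: H1norm_le_sum.
- exact: cvg_cst.
- have cs := cvgD (cvgD c0 cy) cz; rewrite !addr0 in cs; exact: cs.
Qed.

Lemma B1_phase (beta : R) (u : jet R) r :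
  B1 beta (phase (- beta) u) r = - 2 * ci * fdy u r * expi (- beta * r.1).
Proof.
have ci2 : ci * ci = -1 :> R[i].
  by apply: complex_ext; rewrite ?Re_mulc ?Im_mulc ?Re_oppc ?Im_oppc /=; ring.
rewrite /B1 /= rmorphN.
set e := expi _; set b := beta%:C; set p := fval u r; set q := fdy u r.
have -> : 2 * (b * (p * e) - ci * ((q + ci * - b * p) * e)) =
  2 * b * p * e - 2 * ci * q * e + 2 * (ci * ci) * b * p * e by ring.
by rewrite ci2; ring.
Qed.

(** B_1 and B_2 are -2i d_y u and -eps u multiplied by e^{-i beta y}.  They are
    linearly independent because eps u is orthogonal to the diffraction solution
    while d_y u is not. *)
Lemma BIC_tests (d : R) (eps : R * R -> R) (beta k : R) (u v : jet R) :
  symmetric_dielectric L d eps -> reference_BIC L d eps beta k u v ->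
  L2 S (B1 beta (phase (- beta) u)) -> L2 S (B2 eps (phase (- beta) u)) ->
  exists psi1 psi2, [/\ test_fun (strip L) psi1, test_fun (strip L) psi2 &
    pairing L (B1 beta (phase (- beta) u)) psi1
      * pairing L (B2 eps (phase (- beta) u)) psi2
    - pairing L (B1 beta (phase (- beta) u)) psi2
      * pairing L (B2 eps (phase (- beta) u)) psi1 <> 0].
Proof.
move=> [_ eps0 _ _ _] [[[_ _ [_ Hu _ _ _] _] _ _ _ u1]].
move=> [sigma [_ _ [_ [_ _ _ [ou1 ou2]]] du1 du2]] HB1 HB2.
have e0 (r : R * R) : expi (- beta * r.1) != 0 :> R[i].
  apply/eqP => /(congr1 (@ComplexField.Normc.normc R)).
  by rewrite normc_expi normcR normr0 => /eqP; rewrite oner_eq0.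
have epsC r : (eps r)%:C != 0 :> R[i].
  by rewrite (_ : 0 = (0 : R)%:C) // (inj_eq (@complexI R)) gt_eqF.
apply: separating_tests => //.
  move=> h.
  have u0 : {ae mu, forall r, S r -> normc (fval u r) <= `|0 : R|}.
    apply: (ae_imp h) => r /[apply]; rewrite /B2 /= => /eqP.
    rewrite oppr_eq0 !mulf_eq0 (negbTE (epsC r)) (negbTE (e0 r)) orbF /=.
    by move=> /eqP ->; rewrite normcR normr0.
  have [Hu0 _ _ _] := Hu.
  have [h0 n0] := sqint0 mu S.
  have [_] := L2_dominated (L2_cmeasurable Hu0) h0 u0.
  by rewrite n0 u1 ler10.
move=> c h; apply: du2.
(* B_1 = c B_2 reads 2i d_y u = c eps u *)
pose c' : R[i] := - (c * ci) / 2.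
have ci2 : ci * ci = -1 :> R[i].
  by apply: complex_ext; rewrite ?Re_mulc ?Im_mulc ?Re_oppc ?Im_oppc /=; ring.
have E : {ae mu, forall r, S r -> fdy u r * conjc (fval v r) =
     c' * ((eps r)%:C * fval u r * conjc (fval v r))}.
  apply: (ae_imp h) => r /[apply]; rewrite B1_phase /B2 /=.
  set q := fdy u r; set p := fval u r; set ep := (eps r)%:C; set e := expi _ => E.
  have {}E : (- 2 * ci * q) = - c * ep * p.
    by apply: (mulIf (e0 r)); rewrite -/e E; ring.
  have -> : q = ci * (- 2 * ci * q) / 2 + (1 + ci * ci) * q by field.
  by rewrite E ci2 /c'; field.
have [iC eC] := cintegrableZ c' ou1.
rewrite /ip (cint_ae (cint_cmeasurable du1) (cint_cmeasurable iC) E) eC.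
by rewrite -/(ip L _ _) ou2 mulr0.
Qed.

(** Testing the equation of phi_j against psi1 and psi2 gives two linear
    equations for tau_j and g_j, whose remaining terms are controlled by phi_j
    and D_j. *)
Lemma coefficient_bound (eps F : R * R -> R) (beta k Me : R)
    (phi : nat -> jet R) (tau g : nat -> R) psi1 psi2 :
  measurable_fun (setT : set T) eps -> {ae mu, forall r, `|eps r| <= Me} ->
  0 <= Me -> (forall j, H1 L (phi j)) ->
  (forall j, L2 S (Dseq eps F beta phi tau g j)) ->
  L2 S (B1 beta (phi 0%N)) -> L2 S (B2 eps (phi 0%N)) ->
  (forall j, (1 <= j)%N ->
    Lstar_solution eps beta k (phi j) (rhs eps F beta phi tau g j)) ->
  test_fun (strip L) psi1 -> test_fun (strip L) psi2 ->
  pairing L (B1 beta (phi 0%N)) psi1 * pairing L (B2 eps (phi 0%N)) psi2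
  - pairing L (B1 beta (phi 0%N)) psi2 * pairing L (B2 eps (phi 0%N)) psi1 <> 0 ->
  exists2 K, 0 <= K & forall j, (1 <= j)%N -> `|tau j| + `|g j| <=
    K * (H1norm L (phi j) + L2norm L (Dseq eps F beta phi tau g j)).
Proof.
move=> meps eM Me0 Hphi HD HB1 HB2 Hsol t1 t2 D0.
have collect (y1 y2 y3 y4 y5 np ny nz b m a D : R) :
    y1 <= 2 * a * ny -> y2 <= 2 * a * nz -> b * y3 <= b * (2 * a * np) ->
    y4 <= 2 * (m * a) * np -> y5 <= 2 * D * np ->
    0 <= np -> 0 <= ny -> 0 <= nz -> 0 <= b -> 0 <= m -> 0 <= a -> 0 <= D ->
    y1 + y2 + (b * y3 + y4) + y5 <=
    (2 * ny + 2 * nz + (2 * b + 2 * m + 2) * np) * (a + D).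
  move=> q1 q2 q3 q4 q5 np0 ny0 nz0 b0 m0 a0 D1.
  have r1 := mulr_ge0 D1 ny0; have r2 := mulr_ge0 D1 nz0.
  have r3 := mulr_ge0 D1 (mulr_ge0 b0 np0).
  have r4 := mulr_ge0 D1 (mulr_ge0 m0 np0).
  have r5 := mulr_ge0 a0 np0.
  lra.
pose c r := k ^+ 2 * eps r - beta ^+ 2.
pose Mc := k ^+ 2 * Me + beta ^+ 2.
have Mc0 : 0 <= Mc by apply: addr_ge0; [apply: mulr_ge0 => //|]; exact: sqr_ge0.
have mc : measurable_fun (setT : set T) c.
  by rewrite /c; apply: measurable_funB; [apply: measurable_funM|].
have cM : {ae mu, forall r, `|c r| <= Mc}.
  apply: (ae_imp eM) => r er; apply: (le_trans (ler_normB _ _)).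
  by rewrite normrM !(ger0_norm (sqr_ge0 _)) lerD// ler_wpM2l ?sqr_ge0.
have tested psi : test_fun (strip L) psi -> exists2 E, 0 <= E & forall j, (1 <= j)%N ->
    normc ((tau j)%:C * pairing L (B1 beta (phi 0%N)) psi
           + (g j)%:C * pairing L (B2 eps (phi 0%N)) psi) <=
    E * (H1norm L (phi j) + L2norm L (Dseq eps F beta phi tau g j)).
  move=> tp; have [sp sy sz] := test_fun_sqint tp.
  pose np := sqnorm mu S psi; pose ny := sqnorm mu S ('D_((1, 0) : R * R) psi).
  pose nz := sqnorm mu S ('D_((0, 1) : R * R) psi).
  have np0 : 0 <= np := sqnorm_ge0 _ _ _.
  have ny0 : 0 <= ny := sqnorm_ge0 _ _ _.
  have nz0 : 0 <= nz := sqnorm_ge0 _ _ _.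
  pose b := normc (2 * ci * beta%:C : R[i]); have b0 : 0 <= b := normc_ge0 _.
  have two0 : 0 <= 2 :> R := ler0n R 2.
  have E0 : 0 <= 2 * ny + 2 * nz + (2 * b + 2 * Mc + 2) * np.
    apply: addr_ge0; first exact: (addr_ge0 (mulr_ge0 two0 ny0) (mulr_ge0 two0 nz0)).
    apply: (mulr_ge0 _ np0); apply: (addr_ge0 _ two0).
    exact: (addr_ge0 (mulr_ge0 two0 b0) (mulr_ge0 two0 Mc0)).
  exists (2 * ny + 2 * nz + (2 * b + 2 * Mc + 2) * np); first exact: E0.
  move=> j j1.
  have [H0 Hy Hz _] := Hphi j.
  have [Hc1 Hc2] := L2_mul_Linfty mc cM Mc0 H0.
  have [Ht _] := L2Z (tau j)%:C HB1; have [Hg _] := L2Z (g j)%:C HB2.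
  have [Htg _] := L2D Ht Hg; have [HD' _] := L2Z (-1) (HD j).
  have [Hr _] := L2D Htg HD'.
  have rE : rhs eps F beta phi tau g j = (fun r => (tau j)%:C * B1 beta (phi 0%N) r
      + (g j)%:C * B2 eps (phi 0%N) r + -1 * Dseq eps F beta phi tau g j r).
    by apply/funext => r; rewrite /rhs mulN1r.
  have := Hsol j j1; rewrite /Lstar_solution rE => ws.
  have := weak_solution_pairing Hy Hz Hc1 Hr ws tp.
  rewrite (pairingDl Htg HD' sp) (pairingDl Ht Hg sp) (pairingZl _ HB1 sp).
  rewrite (pairingZl _ HB2 sp) (pairingZl _ (HD j) sp) mulN1r => /eqP.
  rewrite subr_eq => /eqP ->.
  have [f1 f2 f3] := L2norm_le_H1norm L (phi j).
  have p1 := pairing_bound Hy sy; have p2 := pairing_bound Hz sz.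
  have p3 := pairing_bound Hy sp; have p4 := pairing_bound Hc1 sp.
  have p5 := pairing_bound (HD j) sp.
  rewrite -/np -/ny -/nz in p1 p2 p3 p4 p5.
  have a0 := H1norm_ge0 L (phi j).
  have D1 := L2norm_ge0 L (Dseq eps F beta phi tau g j).
  move: p1 p2 p3 p4 p5 f1 f2 f3 Hc2 a0 D1.
  set x1 := pairing _ _ _; set x2 := pairing _ _ _; set x3 := pairing _ _ _.
  set x4 := pairing _ _ _; set x5 := pairing _ _ _.
  set a := H1norm L (phi j); set D := L2norm L (Dseq _ _ _ _ _ _ _).
  set l0 := L2norm L (fval _); set ly := L2norm L (fdy _); set lz := L2norm L (fdz _).
  set lc := L2norm _ _ => p1 p2 p3 p4 p5 f1 f2 f3 Hc2 a0 D1.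
  apply: (le_trans (le_normcD _ _)).
  apply: (le_trans (lerD (le_normcD _ _) (lexx _))).
  rewrite normcN.
  apply: (le_trans (lerD (lerD (le_normcD _ _) (le_normcD _ _)) (lexx _))).
  rewrite ComplexField.Normc.normcM -/b.
  have q1 : normc x1 <= 2 * a * ny.
    exact: (le_trans p1 (ler_wpM2r ny0 (ler_wpM2l two0 f2))).
  have q2 : normc x2 <= 2 * a * nz.
    exact: (le_trans p2 (ler_wpM2r nz0 (ler_wpM2l two0 f3))).
  have q3 : b * normc x3 <= b * (2 * a * np).
    exact: (ler_wpM2l b0 (le_trans p3 (ler_wpM2r np0 (ler_wpM2l two0 f2)))).
  have q4 : normc x4 <= 2 * (Mc * a) * np.
    exact: (le_trans p4 (ler_wpM2r np0 (ler_wpM2l two0 (le_trans Hc2 (ler_wpM2l Mc0 f1))))).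
  exact: (collect _ _ _ _ _ _ _ _ _ _ _ _ q1 q2 q3 q4 p5 np0 ny0 nz0 b0 Mc0 a0 D1).
have [E1 E10 h1] := tested psi1 t1; have [E2 E20 h2] := tested psi2 t2.
set p1 := pairing L (B1 _ _) psi1 in D0 h1; set q1 := pairing L (B2 _ _) psi1 in D0 h1.
set p2 := pairing L (B1 _ _) psi2 in D0 h2; set q2 := pairing L (B2 _ _) psi2 in D0 h2.
pose Q := (normc p1 + normc q1 + normc p2 + normc q2) / normc (p1 * q2 - p2 * q1).
have Q0 : 0 <= Q by rewrite divr_ge0 ?addr_ge0 ?normc_ge0.
exists ((E1 + E2) * Q); first by rewrite mulr_ge0// addr_ge0.
move=> j j1; set Y := H1norm _ _ + _.
have Y0 : 0 <= Y by rewrite addr_ge0 ?H1norm_ge0 ?L2norm_ge0.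
rewrite mulrAC; apply: cramer_bound => //.
  by apply: (le_trans (h1 j j1)); rewrite ler_wpM2r// lerDl.
by apply: (le_trans (h2 j j1)); rewrite ler_wpM2r// lerDr.
Qed.

End Convergence.

Theorem lemma5p4 (R : realType) (L d : R) (eps F : R * R -> R)
    (beta k : R) (u v : jet R) (phi : nat -> jet R) (tau g : nat -> R) :
  0 < L -> 0 < d ->
  symmetric_dielectric L d eps ->
  reference_BIC L d eps beta k u v ->
  symmetric_perturbation L d F ->
  perturbation_sequences L eps F beta k u v phi tau g ->
  H1_estimate L eps F beta phi tau g ->
  exists2 delta_star : R, 0 < delta_star &
    forall delta : R, `|delta| <= delta_star ->
      [/\ H1_convergent L (jet_psum delta phi),
          cvgn (series (fun j => tau j * delta ^+ j)) &
          cvgn (series (fun j => g j * delta ^+ j))].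
Proof.
move=> _ _ Heps Href HF [[phi0 _ _] Hseq] [C HC].
have [[meps [Me' eM']] _ _ _ _] := Heps.
have [[mF [MF' FM']] _ _ _] := HF.
have abs_bound (h : R * R -> R) (M : R) : {ae @leb2 R, forall r, `|h r| <= M} ->
    {ae @leb2 R, forall r, `|h r| <= `|M|}.
  by move=> hM; apply: (ae_imp hM) => r hr; apply: (le_trans hr); exact: ler_norm.
have eM := abs_bound _ _ eM'; have FM := abs_bound _ _ FM'.
have Hu : H1 L u by case: Href => -[[_ _ []]].
have Hphi j : H1 L (phi j).
  by case: j => [|j]; [rewrite phi0; exact: H1_phase|have [_ [[]]] := Hseq j.+1 isT].
have Hsol j : (1 <= j)%N ->
    Lstar_solution eps beta k (phi j) (rhs eps F beta phi tau g j).
  by move=> /Hseq [_ []].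
have DX j := Dseq_L2 beta tau g j meps eM (normr_ge0 _) mF FM (normr_ge0 _) Hphi.
pose X i := H1norm L (phi i) + `|tau i| + `|g i|.
pose KD := `|MF'| + `|Me'| + 2 * `|beta| + 3.
have KD0 : 0 <= KD by rewrite !addr_ge0// mulr_ge0.
have HD j : L2 (strip L) (Dseq eps F beta phi tau g j) by have [] := DX j.
have [H0 Hy _ _] := Hphi 0%N.
have HB1 : L2 (strip L) (B1 beta (phi 0%N)).
  have [h1 _] := L2Z (2 * beta%:C) H0; have [h2 _] := L2Z (- 2 * ci) Hy.
  have [+ _] := L2D h1 h2; congr L2; apply/funext => r.
  by rewrite /B1; ring.
have HB2 : L2 (strip L) (B2 eps (phi 0%N)).
  have [h1 _] := L2_mul_Linfty meps eM (normr_ge0 _) H0.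
  have [+ _] := L2Z (-1) h1; congr L2; apply/funext => r.
  by rewrite /B2 mulN1r.
have [psi1 [psi2 [t1 t2 D0]]] : exists psi1 psi2,
    [/\ test_fun (strip L) psi1, test_fun (strip L) psi2 &
    pairing L (B1 beta (phi 0%N)) psi1 * pairing L (B2 eps (phi 0%N)) psi2
    - pairing L (B1 beta (phi 0%N)) psi2 * pairing L (B2 eps (phi 0%N)) psi1 <> 0].
  by rewrite phi0 in HB1 HB2 *; exact: BIC_tests Heps Href HB1 HB2.
have [K K0 HK] := coefficient_bound meps eM (normr_ge0 _) Hphi HD HB1 HB2 Hsol t1 t2 D0.
have X0 i : 0 <= X i by rewrite !addr_ge0// H1norm_ge0.
pose K' := `|C| + K * (`|C| + 1).
have K'0 : 0 <= K' by rewrite addr_ge0// mulr_ge0// addr_ge0.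
have XD j : (1 <= j)%N -> X j <= K' * L2norm L (Dseq eps F beta phi tau g j).
  move=> j1; have D1 := L2norm_ge0 L (Dseq eps F beta phi tau g j).
  have a1 : H1norm L (phi j) <= `|C| * L2norm L (Dseq eps F beta phi tau g j).
    by apply: (le_trans (HC j j1)); rewrite ler_wpM2r// ler_norm.
  have := HK j j1; rewrite /X /K'.
  set a := H1norm L (phi j) in a1 *; set D := L2norm _ _ in a1 D1 *.
  have a2 : K * (a + D) <= K * (`|C| * D + D) by rewrite ler_wpM2l// lerD2r.
  lra.
have [||rho rho0 [A HA]] := @cubic_recurrence_summable R X (K' * KD) X0.
- by rewrite mulr_ge0.
- move=> j j1; apply: (le_trans (XD j j1)); rewrite -mulrA ler_wpM2l//.
  by have [] := DX j.
exists rho => // delta dr.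
have rj j : 0 <= rho ^+ j by rewrite exprn_ge0// ltW.
split.
- apply: (H1_series_cvg dr Hphi) => N; apply: le_trans (HA N).
  by apply: ler_sum => j _; rewrite ler_wpM2r// /X -addrA lerDl addr_ge0.
- apply: (abs_series_cvg dr) => N; apply: le_trans (HA N).
  by apply: ler_sum => j _; rewrite ler_wpM2r// /X addrAC lerDr addr_ge0// H1norm_ge0.
- apply: (abs_series_cvg dr) => N; apply: le_trans (HA N).
  by apply: ler_sum => j _; rewrite ler_wpM2r// /X lerDr addr_ge0// H1norm_ge0.
Qed.
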